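(* Let $f,g_1,\ldots,g_m\colon\mathbb{R}^n\to\mathbb{R}$ be polynomial functions with $m+1\le n$, let $$S:=\{x\in\mathbb{R}^n\mid g_1(x)\le0,\ldots,g_m(x)\le0\},\qquad \psi(x):=\max\{g_1(x),\ldots,g_m(x),0\},$$ and assume that $S\neq\emptyset$ and $\inf_{x\in S}f(x)$ is finite. Assume that the mapping $(f,g_1,\ldots,g_m)\colon\mathbb{R}^n\to\mathbb{R}^{m+1}$ is convenient and non-degenerate at infinity. Then the following properties are equivalent: (i) there exist constants $c_*>0$, $\alpha>0$ and $\beta>0$ with $\alpha\le1\le\beta$ such that for all $c>c_*$, $$\inf_{x\in S}f(x)=\inf_{x\in\mathbb{R}^n}\left\{f(x)+c\left([\psi(x)]^\alpha+[\psi(x)]^\beta\right)\right\}>-\infty;$$ (ii) for any $M\ge0$, the polynomial $f$ is bounded from below on the set $S_M:=\{x\in\mathbb{R}^n\mid g_1(x)\le M,\ldots,g_m(x)\le M\}$. When these equivalent properties hold, one has moreover (with $c_*,\alpha,\beta$ as in (i)) for all $c>c_*$ that $$\mathrm{argmin}_S f(x)=\mathrm{argmin}_{\mathbb{R}^n}\left\{f(x)+c\left([\psi(x)]^\alpha+[\psi(x)]^\beta\right)\right\}\ne\emptyset.$$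
   Context: Let $\mathbb{R}^*:=\mathbb{R}\setminus\{0\}$ and let $\mathbb{Z}_+$ be the set of non-negative integers. For a polynomial $h=\sum_\kappa c_\kappa x^\kappa$ on $\mathbb{R}^n$ (where $x^\kappa=x_1^{\kappa_1}\cdots x_n^{\kappa_n}$, $\kappa\in\mathbb{Z}_+^n$), its support is $\mathrm{supp}(h):=\{\kappa\mid c_\kappa\ne0\}$ and its Newton polyhedron (at infinity) $\Gamma(h)$ is the convex hull in $\mathbb{R}^n$ of $\mathrm{supp}(h)$. The polynomial $h$ is convenient if $\Gamma(h)$ intersects each coordinate axis at a point different from the origin. For $q\in\mathbb{R}^n$ put $$d(q,\Gamma):=\min\{\langle q,\kappa\rangle\mid\kappa\in\Gamma\},\qquad \Delta(q,\Gamma):=\{\kappa\in\Gamma\mid\langle q,\kappa\rangle=d(q,\Gamma)\},$$ and for a face $\Delta$ of $\Gamma(h)$ put $h_\Delta(x):=\sum_{\kappa\in\Delta}c_\kappa x^\kappa$. Let $F=(f_1,\ldots,f_p)\colon\mathbb{R}^n\to\mathbb{R}^p$, $1\le p\le n$, be a polynomial mapping. $F$ is convenient if all $f_i$ are convenient. $F$ is Khovanskii non-degenerate at infinity if for any $q\in\mathbb{R}^n$ with $d(q,\Gamma(f_i))<0$ for $i=1,\ldots,p$, there are no $x\in(\mathbb{R}^* )^n$ and $\lambda\in(\mathbb{R}^* )^p$ such that $f_{i,\Delta_i}(x)=0$ for $i=1,\ldots,p$ and $\sum_{i=1}^p\lambda_i\nabla f_{i,\Delta_i}(x)=0$, where $\Delta_i:=\Delta(q,\Gamma(f_i))$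 and $f_{i,\Delta_i}:=(f_i)_{\Delta_i}$. $F$ is non-degenerate at infinity if for each $k$-tuple $1\le i_1<\cdots<i_k\le p$ the mapping $(f_{i_1},\ldots,f_{i_k})\colon\mathbb{R}^n\to\mathbb{R}^k$ is Khovanskii non-degenerate at infinity. $\mathrm{argmin}$ denotes the set of global minimizers on the indicated set. *)

(* Defs.v *)
From HB Require Import structures.
From mathcomp Require Import all_boot all_order all_algebra.
(* The notations of multinomials clash with those of mathcomp-analysis, hence
   [mpoly n R] for {mpoly R[n]}, [meval v p] for p.@[v] and so on. *)
From mathcomp.multinomials Require Import -(notations) mpoly.
From mathcomp Require Import all_classical all_reals all_analysis.

Set Implicit Arguments.
Unset Strict Implicit.
Unset Printing Implicit Defensive.

Import Order.TTheory GRing.Theory Num.Theory.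

Local Open Scope classical_set_scope.
Local Open Scope ring_scope.

Section PolynomialFunctions.
Context {R : realType} {n : nat}.
Implicit Types (h : mpoly n R) (x : 'rV[R]_n).

Definition polyfun h x : R := meval (x 0) h.

Definition gradient h x : 'rV[R]_n := \row_j polyfun (mderiv j h) x.

End PolynomialFunctions.

Section NewtonPolyhedron.
Context {R : realType} {n : nat}.
Implicit Types (h : mpoly n R) (q u v : 'rV[R]_n) (G D : set 'rV[R]_n).

Definition exponent_vec (k : multinom n) : 'rV[R]_n := \row_j (k j)%:R.

Definition convex_hull (E : lmodType R) (A : set E) : set E :=
  smallest (@convex_set R E) A.

Definition newton_polyhedron h : set 'rV[R]_n :=
  convex_hull [set exponent_vec k | k in [set k | k \in msupp h]].

Definition dotprod u v : R := \sum_j u 0 j * v 0 j.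

(* The inf_over is a minimum when G is a Newton polyhedron of a nonzero
   polynomial; when G is empty [inf] returns 0. *)
Definition face_value q G : R := inf [set dotprod q k | k in G].

Definition face q G : set 'rV[R]_n :=
  [set k | G k /\ dotprod q k = face_value q G].

Definition face_part D h : mpoly n R :=
  \sum_(k <- msupp h | `[< D (exponent_vec k) >]) mcoeff k h *: mpolyX R k.

Definition principal_part q h : mpoly n R :=
  face_part (face q (newton_polyhedron h)) h.

Definition convenient_poly h : Prop :=
  forall j : 'I_n, exists2 t : R,
    t != 0 & newton_polyhedron h (t *: delta_mx 0 j).

End NewtonPolyhedron.

Section NonDegeneracy.
Context {R : realType} {n : nat}.

Definition convenient p (F : 'I_p -> mpoly n R) : Prop :=
  forall i, convenient_poly (F i).

Definition khovanskii_nondegenerate_at_infinity p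
    (F : 'I_p -> mpoly n R) : Prop :=
  forall q : 'rV[R]_n,
    (forall i, face_value q (newton_polyhedron (F i)) < 0) ->
    ~ exists (x : 'rV[R]_n) (lambda : 'I_p -> R),
        [/\ forall j, x 0 j != 0,
            forall i, lambda i != 0,
            forall i, polyfun (principal_part q (F i)) x = 0
          & \sum_i lambda i *: gradient (principal_part q (F i)) x = 0].

(* The tuples i_1 < ... < i_k are nonempty: the condition on the empty mapping
   would be false. *)
Definition nondegenerate_at_infinity p (F : 'I_p -> mpoly n R) : Prop :=
  forall (k : nat) (s : 'I_k -> 'I_p), (0 < k)%N ->
    {homo s : a b / (a < b)%N} -> khovanskii_nondegenerate_at_infinity (F \o s).

End NonDegeneracy.

Section Optimization.
Context {R : realType} {n m : nat}.
Implicit Types (f : mpoly n R) (g : 'I_m -> mpoly n R) (x : 'rV[R]_n).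

Definition cons_map f g : 'I_m.+1 -> mpoly n R :=
  fun i => if unlift ord0 i is Some j then g j else f.

Definition sublevel g (M : R) : set 'rV[R]_n :=
  [set x | forall i, polyfun (g i) x <= M].

Definition feasible g : set 'rV[R]_n := sublevel g 0.

Definition violation g x : R := \big[Num.max/0]_(i < m) polyfun (g i) x.

Definition penalized f g (c alpha beta : R) x : R :=
  polyfun f x + c * (violation g x `^ alpha + violation g x `^ beta).

Definition inf_over (A : set 'rV[R]_n) (h : 'rV[R]_n -> R) : \bar R :=
  ereal_inf [set (h x)%:E | x in A].

Definition argmin (A : set 'rV[R]_n) (h : 'rV[R]_n -> R) : set 'rV[R]_n :=
  [set x | A x /\ forall y, A y -> h x <= h y].

Definition exact_penalty f g (c0 alpha beta : R) : Prop :=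
  [/\ 0 < c0, 0 < alpha, 0 < beta, alpha <= 1 <= beta
    & forall c, c0 < c ->
        inf_over (feasible g) (polyfun f)
          = inf_over setT (penalized f g c alpha beta)
        /\ (-oo < inf_over setT (penalized f g c alpha beta))%E].

End Optimization.

(* Main.v *)
Require Import Defs.
From HB Require Import structures.
From mathcomp Require Import all_boot all_order all_algebra.
From mathcomp.multinomials Require Import -(notations) mpoly.
From mathcomp.real_closed Require ordered_qelim qe_rcf polyrcf.
From mathcomp Require Import all_classical all_reals all_analysis.
From mathcomp Require Import ring lra.

(** The proof rests on coercivity: if [F = (f, g_1, ..., g_m)] is convenient
    and non-degenerate at infinity and [f] is bounded below on the feasible
    set [S], then every set [{g <= t, f <= a}] is compact
    ([sublevel_compact]).  This holds
    because, if some set [{F <= M}] is unbounded, then all the [F_i] can be made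
    arbitrarily negative at a common point ([bounded_below_sublevel_bounded]);
    such points are feasible, and [f] would be unbounded below on them.

    To see this, move the points of the unbounded set slightly off the
    coordinate hyperplanes and follow them along an ultrafilter.  The
    logarithms [w] of the absolute values of the coordinates split as
    [w = w' + u], where [w'] converges, and where a single late value of [-u]
    is a weight [q] that orders the exponents as the reverse of the asymptotic
    order of the corresponding monomials ([limiting_weight]).  Dividing [F_i]
    by its dominant monomial, which tends to infinity by convenience, shows
    that the principal part of [F_i] for [q] is nonpositive at the point with
    the limiting signs and logarithms [lim w'] ([unbounded_principal_parts]).
    Non-degeneracy says that the gradients of those principal parts that
    vanish there are linearly independent, so some direction decreases all of
    them at once, and all the principal parts become negative at a nearby
    point [y] ([principal_parts_lt0]).  Along the curve
    [y_j * exp (- s * q_j)], every [F_i] tends to minus infinity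
    ([polyfun_curve_Ny]).

    Compactness gives minimizers on every sublevel set of the constraints,
    whence (ii) and the nonemptiness of argmin, and it gives
    [mu t -> fstar] as [t -> 0+], where [mu t] is the minimum of [f] on
    [{g <= t}] and [fstar = mu 0].  By quantifier elimination over the reals,
    [mu] satisfies a nontrivial polynomial equation [P (t, mu t) = 0]
    ([value_function_algebraic]).  Root bounds for [P] when [t] is large, and
    the lowest-order terms of [P] at [(0, fstar)], yield
    [fstar - mu t <= C * (t ^ alpha + t ^ beta)] with [alpha <= 1 <= beta]
    ([algebraic_holder_bound]), and this is (i): take [t] to be the violation
    of the constraints at [x].  So both (i) and (ii) hold under the
    hypotheses.  Equality of the sets of minimizers follows by comparing the
    penalty coefficient [c] with a smaller admissible one: a penalized
    minimizer of positive violation would beat [fstar] for the smaller one. *)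

Set Implicit Arguments.
Unset Strict Implicit.
Unset Printing Implicit Defensive.

Import Order.TTheory GRing.Theory Num.Theory.
Import numFieldNormedType.Exports ordered_qelim.

Local Open Scope classical_set_scope.
Local Open Scope ring_scope.

(** * Polynomial functions as sums of monomials, and their Newton polyhedra *)

Section PolyExpansion.
Context {R : realType} {n : nat}.
Implicit Types (h : mpoly n R) (x q u : 'rV[R]_n) (k : multinom n).

Definition monom k x : R := \prod_j x 0 j ^+ k j.

Lemma polyfunE h x :
  polyfun h x = \sum_(k <- msupp h) mcoeff k h * monom k x.
Proof. by rewrite /polyfun mevalE. Qed.

Lemma face_partE (D : set 'rV[R]_n) h x :
  polyfun (face_part D h) x =
  \sum_(k <- msupp h | `[< D (exponent_vec k) >]) mcoeff k h * monom k x.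
Proof.
rewrite /polyfun /face_part raddf_sum /=.
by apply: eq_bigr => k _; rewrite mevalZ mevalX.
Qed.

Definition exponent_dot u k : R := dotprod u (exponent_vec k).

Lemma exponent_dotE u k : exponent_dot u k = \sum_j u 0 j * (k j)%:R.
Proof. by apply: eq_bigr => j _; rewrite mxE. Qed.

Lemma newton_polyhedron_supp h k :
  k \in msupp h -> newton_polyhedron h (exponent_vec k).
Proof. by move=> hk; apply: sub_gen_smallest; exists k. Qed.

(** A half-space is convex, so linear inequalities pass from the support to its
    convex hull. *)
Lemma newton_polyhedron_halfspace h u (c : R) :
  (forall k, k \in msupp h -> c <= exponent_dot u k) ->
  forall v, newton_polyhedron h v -> c <= dotprod u v.
Proof.
move=> hc v hv.
apply: (hv [set v | c <= dotprod u v]); split; last first.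
  by move=> _ [k hk <-]; exact: hc.
move=> a b t; rewrite !inE /= => ha hb.
have -> : dotprod u (conv t a b : 'rV[R]_n) =
    t%:num * dotprod u (a : 'rV[R]_n) + (1 - t%:num) * dotprod u (b : 'rV[R]_n).
  rewrite /dotprod !mulr_sumr -big_split /=; apply: eq_bigr => j _.
  by rewrite !mxE /= /unstable.onem; ring.
have t0 : 0 <= t%:num by [].
have t1 : t%:num <= 1 by [].
by nra.
Qed.

Lemma face_value_min h q k0 : k0 \in msupp h ->
  (forall k, k \in msupp h -> exponent_dot q k0 <= exponent_dot q k) ->
  face_value q (newton_polyhedron h) = exponent_dot q k0.
Proof.
move=> hk0 hmin; apply/eqP; rewrite eq_le; apply/andP; split.
  apply: ge_inf; last by exists (exponent_vec k0) => //; exact: newton_polyhedron_supp.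
  exists (exponent_dot q k0) => _ [v hv <-].
  exact: newton_polyhedron_halfspace hv.
apply: lb_le_inf.
  by exists (exponent_dot q k0), (exponent_vec k0) => //; exact: newton_polyhedron_supp.
by move=> _ [v hv <-]; exact: newton_polyhedron_halfspace hv.
Qed.

Lemma principal_partE q h x : polyfun (principal_part q h) x =
  \sum_(k <- msupp h | exponent_dot q k == face_value q (newton_polyhedron h))
     mcoeff k h * monom k x.
Proof.
rewrite /principal_part face_partE big_seq_cond [RHS]big_seq_cond.
apply: eq_bigl => k; case hk: (k \in msupp h) => //=.
apply/asboolP/eqP => [[]//|e]; split=> //; exact: newton_polyhedron_supp.
Qed.

(** A point of the polyhedron on the [j]-th axis forces a support point there:
    otherwise the functional that is [-1] on the [j]-th axis and very large on
    the others would be nonnegative on the support, hence on the polyhedron,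
    but it is negative on the positive half-axis. *)
Lemma convenient_polyP h : convenient_poly h -> forall j : 'I_n,
  exists k, [/\ k \in msupp h, (0 < k j)%N & forall l, l != j -> k l = 0%N].
Proof.
move=> hconv j; have [t t0 ht] := hconv j.
have dot_axis u : dotprod u (t *: delta_mx 0 j) = u 0 j * t.
  rewrite /dotprod (bigD1 j)//= big1 ?addr0 => [|l lj]; rewrite !mxE ?eqxx ?mulr1//.
  by rewrite (negbTE lj) andbF !mulr0.
have tgt0 : 0 < t.
  rewrite lt_def t0 /=; have := @newton_polyhedron_halfspace h (delta_mx 0 j) 0 _ _ ht.
  rewrite dot_axis mxE !eqxx mul1r; apply=> k _; rewrite exponent_dotE.
  by apply: sumr_ge0 => l _; rewrite mxE mulr_ge0.
apply: contrapT => hno.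
(* Any bound on the [j]-th coordinates of the support would do. *)
pose A : R := \sum_(k <- msupp h) (k j)%:R.
have A0 : 0 <= A by apply: sumr_ge0.
pose u : 'rV[R]_n := \row_l (if l == j then -1 else A).
have := @newton_polyhedron_halfspace h u 0 _ _ ht.
rewrite dot_axis mxE eqxx mulN1r leNgt oppr_lt0 tgt0 /= => /(_ _)/negP; apply=> // k hk.
have [l lj kl] : exists2 l, (l != j) || (k j == 0)%N & (k j == 0)%N || (0 < k l)%N.
  case: (posnP (k j)) => [kj|kj]; first by exists j; rewrite ?kj // orbT.
  apply: contrapT => hl; apply: hno; exists k; split=> // l lj.
  apply: contrapT => /eqP; rewrite -lt0n => kl; apply: hl.
  by exists l; rewrite ?lj ?kl ?orbT.
rewrite exponent_dotE (bigD1 j)//= mxE eqxx.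
have hge : forall i : 'I_n, i != j -> 0 <= u 0 i * (k i)%:R.
  by move=> i ij; rewrite mxE (negbTE ij) mulr_ge0.
case/orP: kl => [/eqP ->|kl].
  by rewrite mulr0 add0r sumr_ge0.
have [kj|kj] := eqVneq (k j) 0%N; first by rewrite kj mulr0 add0r sumr_ge0.
rewrite (negbTE kj) orbF in lj.
rewrite (bigD1 l)//= mxE (negbTE lj) addrA addr_ge0//; last first.
  by apply: sumr_ge0 => i /andP[ij _]; exact: hge.
have kA : (k j)%:R <= A.
  rewrite /A (bigD1_seq k) ?msupp_uniq//= lerDl; exact: sumr_ge0.
have : (1:R) <= (k l)%:R by rewrite ler1n.
by move=> ?; rewrite mulN1r; nra.
Qed.

End PolyExpansion.

(** * Polynomial functions along lines *)

Section Lines.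
Context {R : realType} {n : nat}.
Implicit Types (h : mpoly n R) (x d : 'rV[R]_n).

Lemma dotprod_gradientE h x d :
  dotprod (gradient h x) d = \sum_j d 0 j * polyfun (mderiv j h) x.
Proof. by apply: eq_bigr => j _; rewrite mxE mulrC. Qed.

(** The restriction to a line is a univariate polynomial; the statement is
    stable under sums and products, hence reduces to the variables. *)
Lemma polyfun_along_line h x d : exists p : {poly R},
  (forall s, p.[s] = polyfun h (x + s *: d)) /\
  p^`().[0] = dotprod (gradient h x) d.
Proof.
rewrite dotprod_gradientE.
pose along h (p : {poly R}) := (forall s, p.[s] = polyfun h (x + s *: d)) /\
  p^`().[0] = \sum_j d 0 j * polyfun (mderiv j h) x.
rewrite -/(along h _).
have alongM h1 h2 p1 p2 : along h1 p1 -> along h2 p2 -> along (h1 * h2) (p1 * p2).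
  case=> [e1 d1] [e2 d2]; split => [s|].
    by rewrite hornerM e1 e2 /polyfun mevalM.
  have e1' : p1.[0] = polyfun h1 x by rewrite e1 scale0r addr0.
  have e2' : p2.[0] = polyfun h2 x by rewrite e2 scale0r addr0.
  rewrite derivM hornerD !hornerM d1 d2 e1' e2'.
  rewrite mulr_suml mulr_sumr -big_split /=; apply: eq_bigr => j _.
  rewrite mderivM /polyfun mevalD !mevalM; ring.
have along1 : along 1 1.
  split=> [s|]; first by rewrite hornerC /polyfun meval1.
  rewrite derivC horner0 big1// => j _.
  by rewrite mderivC /polyfun meval0 mulr0.
have alongX (i : 'I_n) : along (mpolyX R (mnm1 i)) ((x 0 i)%:P + d 0 i *: 'X).
  split=> [s|]; first by rewrite /polyfun mevalXU !hornerE !mxE mulrC.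
  rewrite derivD derivC derivZ derivX !hornerE (bigD1 i)//= big1 ?addr0 => [|j ji].
    by rewrite mderivX mnm1E eqxx /polyfun mevalZ mevalX big1 ?mulr1// => j _;
      rewrite mnmBE subnn expr0.
  rewrite mderivX mnm1E eq_sym (negbTE ji) /polyfun mevalZ mul0r mulr0 //.
elim/mpolyind: h => [|c m h _ _ [p [e dp]]].
  exists 0; split=> [s|]; first by rewrite horner0 /polyfun meval0.
  by rewrite linear0 horner0 big1// => j _; rewrite mderiv0 /polyfun meval0 mulr0.
have [pm [em dm]] : exists pm, along (mpolyX R m) pm.
  rewrite mpolyXE_id.
  elim/big_ind: _ => [|h1 h2 [p1 ?] [p2 ?]|i _]; first by exists 1.
    by exists (p1 * p2); exact: alongM.
  elim: (m i) => [|k [q hq]]; first by exists 1; rewrite expr0.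
  by eexists; rewrite exprS; apply: alongM (alongX i) hq.
exists (c *: pm + p); split=> [s|].
  by rewrite !hornerE em e /polyfun mevalD mevalZ.
rewrite derivD derivZ !hornerE dp dm mulr_sumr -big_split /=.
apply: eq_bigr => j _; rewrite mderivD mderivZ /polyfun mevalD mevalZ; ring.
Qed.

Lemma polyfun_continuous h : continuous (polyfun h).
Proof.
rewrite (funext (polyfunE h)) => x.
apply: (@cvg_big _ _ +%R 0 predT _ _ (nbhs x)) => [|k _].
  exact: add_continuous.
apply: cvgM; first exact: cvg_cst.
rewrite /monom; apply: (@cvg_big R _ *%R 1 predT _ _ (nbhs x) _
  (fun j (y : 'rV[R]_n) => y 0 j ^+ k j)) => [|j _].
  exact: mul_continuous.
apply: (continuous_comp (f := fun x : 'rV[R]_n => x 0 j) (g := fun t => t ^+ k j)).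
  exact: coord_continuous.
exact: exprn_continuous.
Qed.

Lemma polyfun_line_lt0 h x d : polyfun h x < 0 ->
  \forall s \near (0:R)^'+, polyfun h (x + s *: d) < 0.
Proof.
have [p [e _]] := polyfun_along_line h x d.
rewrite -{1}[x]addr0 -(scale0r d) -e => p0.
under eq_near do rewrite -e.
apply: cvg_within; exact: (cvgr_lt _ (@continuous_horner R p 0) _ p0).
Qed.

Lemma polyfun_line_descent h x d : polyfun h x = 0 ->
  dotprod (gradient h x) d < 0 ->
  \forall s \near (0:R)^'+, polyfun h (x + s *: d) < 0.
Proof.
have [p [e <-]] := polyfun_along_line h x d.
rewrite -{1}[x]addr0 -(scale0r d) -e => /eqP p0 dp.
under eq_near do rewrite -e.
have /factor_theorem[q pq] : root p 0 by [].
rewrite subr0 in pq.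
move: dp; rewrite pq derivM derivX !hornerE => q0.
near=> s.
rewrite !hornerE pmulr_llt0//.
near: s; apply: cvg_within; exact: (cvgr_lt _ (@continuous_horner R q 0) _ q0).
Unshelve. all: by end_near. Qed.

End Lines.

(** * Linear independence of principal gradients *)

(** The non-degeneracy condition is stated for increasing tuples of indices, and
    subsets of indices are turned into such tuples by [enum_val]. *)
Lemma enum_val_ltn p (A : {pred 'I_p}) :
  {homo @enum_val _ A : a b / (a < b)%N}.
Proof.
move=> a b ab.
have sorted_A : sorted (relpre val ltn) (enum A).
  have tr : transitive (relpre (@nat_of_ord p) ltn) by move=> x y z; exact: ltn_trans.
  rewrite {1}/enum_mem; apply: (sorted_filter tr).
  by rewrite -enumT -sorted_map val_enum_ord iota_ltn_sorted.
have tr : transitive (relpre (@nat_of_ord p) ltn) by move=> x y z; exact: ltn_trans.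
have x0 : 'I_p by exact: (enum_val a).
rewrite !(enum_val_nth x0).
by apply: (sorted_ltn_nth tr x0 sorted_A); rewrite ?inE -?cardE.
Qed.

Lemma affine_neq0_near {R : realType} (a b : R) : (a != 0) || (b != 0) ->
  \forall s \near (0:R)^'+, a + s * b != 0.
Proof.
have [-> /=|b0 _] := eqVneq b 0.
  by rewrite orbF => a0; near=> s; rewrite mulr0 addr0.
have root_b s : (a + s * b == 0) = (s == - a / b).
  by rewrite addrC addr_eq0 -[in RHS](inj_eq (mulIf b0)) divfK.
under eq_near do rewrite root_b.
have [r0|r0] := leP (- a / b) 0.
  by near=> s; rewrite gt_eqF// (le_lt_trans r0).
by near=> s; rewrite lt_eqF//; near: s; exact: nbhs_right_lt.
Unshelve. all: by end_near. Qed.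

Section Perturbation.
Context {R : realType} {n p : nat}.
Implicit Types (F : 'I_p -> mpoly n R) (x q d : 'rV[R]_n).

(** Independent vectors are the rows of a right invertible matrix, so their
    inner products with a common vector can be prescribed. *)
Lemma independent_descent (I : finType) (A : {set I}) (V : I -> 'rV[R]_n) :
  (forall lambda : 'I_#|A| -> R,
     \sum_a lambda a *: V (enum_val a) = 0 -> forall a, lambda a = 0) ->
  exists d : 'rV[R]_n, forall i, i \in A -> dotprod (V i) d = -1.
Proof.
move=> hV; pose W : 'M[R]_(#|A|, n) := \matrix_(a < #|A|) V (enum_val a).
have /row_freeP[B WB] : row_free W.
  apply: inj_row_free => v vW; apply/rowP => a; rewrite mxE.
  apply: (hV (fun a => v 0 a)); rewrite -[RHS]vW mulmx_sum_row.
  by apply: eq_bigr => b _; rewrite rowK.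
exists (B *m const_mx (-1))^T => i iA.
have WBi : (W *m (B *m const_mx (-1) : 'cV_n)) (enum_rank_in iA i) 0 = -1.
  by rewrite mulmxA WB mul1mx mxE.
rewrite -[RHS]WBi mxE; apply: eq_bigr => j _.
by rewrite !mxE enum_rankK_in.
Qed.

(** Non-degeneracy speaks of combinations all of whose coefficients are nonzero.
    Applying it to the sub-tuple of the indices with nonzero coefficients gives
    genuine linear independence. *)
Lemma principal_gradients_independent F q x (A : {set 'I_p}) :
  nondegenerate_at_infinity F ->
  (forall i, face_value q (newton_polyhedron (F i)) < 0) ->
  (forall j, x 0 j != 0) ->
  (forall i, i \in A -> polyfun (principal_part q (F i)) x = 0) ->
  forall lambda : 'I_#|A| -> R,
    \sum_a lambda a *: gradient (principal_part q (F (enum_val a))) x = 0 ->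
  forall a, lambda a = 0.
Proof.
move=> ndeg q0 x0 A0 lambda sum0 a.
apply: contrapT => /eqP a0.
pose J := [set b | lambda b != 0]%SET.
have J0 : (0 < #|J|)%N by apply/card_gt0P; exists a; rewrite inE.
pose s (b : 'I_#|J|) : 'I_p := enum_val (enum_val b).
have s_incr : {homo s : b c / (b < c)%N} by move=> b c bc; do 2!apply: enum_val_ltn.
apply: (ndeg _ s J0 s_incr q); first by move=> b /=.
exists x, (fun b => lambda (enum_val b)); split => //.
- by move=> b; have := enum_valP b; rewrite inE.
- by move=> b; apply: A0; exact: enum_valP.
- rewrite -(big_enum_val (A := pred_of_set J)
    (fun a => lambda a *: gradient (principal_part q (F (enum_val a))) x)).
  rewrite -[RHS]sum0 [RHS](bigID (mem J))/= [X in _ = _ + X]big1 ?addr0// => b.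
  by rewrite inE negbK => /eqP ->; rewrite scale0r.
Qed.

(** The principal parts that vanish at [x] decrease along a common direction, and
    the others stay negative for small steps. *)
Lemma principal_parts_lt0 F q x :
  nondegenerate_at_infinity F ->
  (forall i, face_value q (newton_polyhedron (F i)) < 0) ->
  (forall j, x 0 j != 0) ->
  (forall i, polyfun (principal_part q (F i)) x <= 0) ->
  exists2 y : 'rV[R]_n, (forall j, y 0 j != 0) &
    forall i, polyfun (principal_part q (F i)) y < 0.
Proof.
move=> ndeg q0 x0 le0.
pose G i := principal_part q (F i).
pose A := [set i | polyfun (G i) x == 0]%SET.
have A0 i : i \in A -> polyfun (G i) x = 0 by rewrite inE => /eqP.
have [d hd] := independent_descent
  (V := fun i => gradient (G i) x) (principal_gradients_independent ndeg q0 x0 A0).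
suff : \forall s \near (0:R)^'+, (forall j, (x + s *: d) 0 j != 0) /\
    forall i, polyfun (G i) (x + s *: d) < 0.
  by move=> /filter_ex[s [? ?]]; exists (x + s *: d).
have coord_neq0 j : \forall s \near (0:R)^'+, (x + s *: d) 0 j != 0.
  have := @affine_neq0_near R (x 0 j) (d 0 j); rewrite x0 => /(_ isT).
  by apply: filterS => s; rewrite !mxE.
have part_lt0 i : \forall s \near (0:R)^'+, polyfun (G i) (x + s *: d) < 0.
  have := le0 i; rewrite le_eqVlt => /orP[/eqP e|]; last exact: polyfun_line_lt0.
  by apply: polyfun_line_descent => //; rewrite hd ?ltrN10// inE e.
by apply: filterI; [exact: filter_forall coord_neq0|exact: filter_forall part_lt0].
Qed.

End Perturbation.

(** * Exponential substitutions and escape along a curve *)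

Section Asymptotics.
Context {R : realType} {n : nat}.
Implicit Types (h : mpoly n R) (q x s w : 'rV[R]_n) (k : multinom n).

(** Points off the coordinate hyperplanes in logarithmic coordinates: [s] carries
    the signs, or a base point, and [w] the logarithms.  Monomials become
    exponentials of linear forms in [w]. *)
Definition exp_point s w : 'rV[R]_n := \row_j (s 0 j * expR (w 0 j)).

Lemma monom_exp_point k s w :
  monom k (exp_point s w) = monom k s * expR (exponent_dot w k).
Proof.
rewrite /monom exponent_dotE expR_sum -big_split /=; apply: eq_bigr => j _.
by rewrite mxE exprMn expRM_natr.
Qed.

(** After division by [expR v], the terms selected by [S] have a finite limit and
    the others tend to zero.  The filter is arbitrary because the lemma serves
    both the explicit curve and the ultrafilter. *)
Lemma polyfun_exp_point_cvg T (F : set_system T) (FF : Filter F) h s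
    (w : T -> 'rV[R]_n) (v : T -> R) (S : pred (multinom n)) (l : multinom n -> R) :
  (forall k, k \in msupp h -> S k ->
     exponent_dot (w t) k - v t @[t --> F] --> l k) ->
  (forall k, k \in msupp h -> ~~ S k ->
     exponent_dot (w t) k - v t @[t --> F] --> -oo) ->
  polyfun h (exp_point s (w t)) * expR (- v t) @[t --> F] -->
  \sum_(k <- msupp h | S k) mcoeff k h * monom k s * expR (l k).
Proof.
move=> hS hNS.
have -> : (fun t => polyfun h (exp_point s (w t)) * expR (- v t)) =
    fun t => \sum_(k <- msupp h | k \in msupp h)
      mcoeff k h * monom k s * expR (exponent_dot (w t) k - v t).
  apply/funext => t; rewrite polyfunE mulr_suml -big_seq; apply: eq_bigr => k _.
  by rewrite monom_exp_point expRD !mulrA.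
rewrite [X in _ --> X]big_mkcond big_seq.
apply: (@cvg_big R _ +%R 0 (fun k => k \in msupp h) _ T F) => [|k hk].
  exact: add_continuous.
case: ifPn => [Sk|Sk].
  apply: cvgM; first exact: cvg_cst.
  by apply: continuous_cvg; [exact: continuous_expR|exact: hS].
rewrite -(mulr0 (mcoeff k h * monom k s)); apply: cvgM; first exact: cvg_cst.
have -> : (fun t => expR (exponent_dot (w t) k - v t)) =
    (fun r => expR (- r)) \o (fun t => - (exponent_dot (w t) k - v t)).
  by apply/funext => t /=; rewrite opprK.
by apply: cvg_comp (@cvgr_expR R); apply/cvgNry; exact: hNS.
Qed.

Lemma face_value_le h q k : k \in msupp h ->
  face_value q (newton_polyhedron h) <= exponent_dot q k.
Proof.
move=> hk; apply: ge_inf; last first.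
  by exists (exponent_vec k) => //; exact: newton_polyhedron_supp.
exists (- \sum_(k <- msupp h) `|exponent_dot q k|) => _ [v hv <-].
apply: newton_polyhedron_halfspace hv => k' hk'.
rewrite lerNl (bigD1_seq k') ?msupp_uniq//=.
by rewrite (le_trans (ler_norm _))// normrN lerDl sumr_ge0.
Qed.

(** The factor [expR (- s * face_value)] tends to infinity, and it multiplies a
    quantity that tends to the value of the principal part at [x]. *)
Lemma polyfun_curve_Ny h q x N :
  face_value q (newton_polyhedron h) < 0 ->
  polyfun (principal_part q h) x < 0 ->
  \forall s \near +oo, polyfun h (exp_point x (- s *: q)) <= N.
Proof.
set d := face_value _ _ => d0 part0.
have lim : polyfun h (exp_point x (- s *: q)) * expR (- (- s * d)) @[s --> +oo]
    --> polyfun (principal_part q h) x.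
  have scaleE (s : R) k :
      exponent_dot (- s *: q) k - - s * d = s * - (exponent_dot q k - d).
    rewrite !exponent_dotE; have -> : \sum_j (- s *: q) 0 j * (k j)%:R =
      - s * \sum_j q 0 j * (k j)%:R.
      by rewrite mulr_sumr; apply: eq_bigr => j _; rewrite mxE mulrA.
    ring.
  have -> : polyfun (principal_part q h) x = \sum_(k <- msupp h | exponent_dot q k == d)
      mcoeff k h * monom k x * expR 0.
    by rewrite principal_partE; apply: eq_bigr => k _; rewrite expR0 mulr1.
  apply: polyfun_exp_point_cvg => k hk hd; under eq_fun do rewrite scaleE.
    by rewrite (eqP hd) subrr oppr0; under eq_fun do rewrite mulr0; exact: cvg_cst.
  have dk : 0 < exponent_dot q k - d.
    by rewrite subr_gt0 lt_neqAle eq_sym hd face_value_le.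
  under eq_fun do rewrite mulrN.
  by apply/cvgNrNy; apply: gt0_cvgMly => //; exact: cvg_id.
set G := polyfun (principal_part q h) x in part0 lim *.
have G2 : G < G / 2 by lra.
near=> s.
have e0 : 0 < expR (- (- s * d)) by exact: expR_gt0.
have eV : expR (- s * d) * expR (- (- s * d)) = 1 by rewrite expRxMexpNx_1.
have es : 1 + - s * d <= expR (- s * d) by exact: expR_ge1Dx.
have : polyfun h (exp_point x (- s *: q)) * expR (- (- s * d)) < G / 2.
  by near: s; exact: (cvgr_lt _ lim).
have sN : - N / (d * (G / 2)) <= s by near: s; apply: nbhs_pinfty_ge; rewrite num_real.
have dG : 0 < d * (G / 2) by nra.
rewrite ler_pdivrMr// in sN.
move: (expR (- (- s * d))) (expR (- s * d)) e0 eV es => E V E0 EV es lt.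
have : polyfun h (exp_point x (- s *: q)) = polyfun h (exp_point x (- s *: q)) * E * V.
  by rewrite -mulrA (mulrC E) EV mulr1.
move: lt; move: (polyfun _ _) => P lt ->.
have V0 : 0 < V by nra.
nra.
Unshelve. all: by end_near. Qed.

End Asymptotics.

(** * Limiting weights of an ultrafilter at infinity *)

Section UltrafilterLimits.
Context {R : realType} {T : Type} (U : set_system T) {UU : UltraFilter U}.

Lemma ultra_fmap (Y : Type) (f : T -> Y) : UltraFilter (f @ U).
Proof.
split=> [|G GF UG]; first exact: fmap_proper_filter.
rewrite eqEsubset; split=> [A GA|]; last exact: UG.
have [//|UnA] := in_ultra_setVsetC (f @^-1` A) UU.
by have /filter_ex[y []] : G (A `&` ~` A) by apply: filterI => //; apply: UG.
Qed.

(** An unbounded function along an ultrafilter tends to an infinity, and a bounded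
    one converges by compactness of segments. *)
Lemma ultra_trichotomy (v : T -> R) :
  [\/ exists l : R, v @ U --> l, v @ U --> +oo | v @ U --> -oo].
Proof.
have [hy|] := pselect (forall B, U [set t | B < v t]).
  by constructor 2; apply/cvgryPgt.
move=> /existsNP[B1 nB1].
have [hNy|] := pselect (forall B, U [set t | v t < B]).
  by constructor 3; apply/cvgrNyPlt.
move=> /existsNP[B2 nB2].
constructor 1.
have : compact `[B2, B1] by exact: segment_compact.
rewrite compact_ultra => /(_ (v @ U)) /=.
case=> [||l []]; last by exists l.
  exact: ultra_fmap.
rewrite /fmap /=.
have [//|u1] := in_ultra_setVsetC [set t | B1 < v t] UU.
have [//|u2] := in_ultra_setVsetC [set t | v t < B2] UU.
apply: filterS2 u1 u2 => t /= /negP; rewrite -leNgt => ? /negP; rewrite -leNgt => ?.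
by rewrite in_itv /=; apply/andP.
Qed.

Lemma cvg_mulmx n p (x : T -> 'rV[R]_n) (l : 'rV[R]_n) (B : 'M[R]_(n, p)) :
  (forall i, x t 0 i @[t --> U] --> l 0 i) ->
  forall j, (x t *m B) 0 j @[t --> U] --> (l *m B) 0 j.
Proof.
move=> xl j; rewrite mxE; under eq_fun do rewrite mxE.
apply: (@cvg_big R _ +%R 0 predT _ T U) => [|i _]; first exact: add_continuous.
by apply: cvgM; [exact: xl|exact: cvg_cst].
Qed.

(** With the convergent directions [e i] as the columns of [X], the map
    [v |-> v *m X *m pinvmx X] does not change inner products with these
    directions and depends on them alone, so its value at [w] converges;
    subtracting it from [w] kills the convergent directions and alters the
    divergent ones by bounded amounts. *)
Lemma ultra_split n (I : finType) (e : I -> 'rV[R]_n) (w : T -> 'rV[R]_n) :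
  exists (winf : 'rV[R]_n) (u : T -> 'rV[R]_n), forall i,
    ((exists l : R, dotprod (w t) (e i) @[t --> U] --> l) ->
      dotprod (w t) (e i) @[t --> U] --> dotprod winf (e i) /\
      forall t, dotprod (u t) (e i) = 0) /\
    (dotprod (w t) (e i) @[t --> U] --> +oo ->
      \forall t \near U, 0 < dotprod (u t) (e i)).
Proof.
pose J := [set i | `[< exists l : R, dotprod (w t) (e i) @[t --> U] --> l >]]%SET.
have JP (a : 'I_#|J|) :
    { l : R | dotprod (w t) (e (enum_val a)) @[t --> U] --> l }.
  by apply: cid; have := enum_valP a; rewrite inE => /asboolP.
pose X := \matrix_(j < n, a < #|J|) e (enum_val a) 0 j.
pose l := \row_a projT1 (JP a).
have dotX (v : 'rV[R]_n) a : dotprod v (e (enum_val a)) = (v *m X) 0 a.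
  by rewrite mxE; apply: eq_bigr => j _; rewrite mxE.
have wX a : (w t *m X) 0 a @[t --> U] --> l 0 a.
  by rewrite mxE; under eq_fun do rewrite -dotX; exact: projT2 (JP a).
have XpX (v : 'rV[R]_n) : v *m X *m pinvmx X *m X = v *m X.
  by rewrite mulmxKpV ?submxMl.
have lX : l *m pinvmx X *m X = l.
  apply/rowP => a; rewrite -mulmxA.
  have := @cvg_mulmx _ _ (fun t => w t *m X) l (pinvmx X *m X) wX a.
  under eq_fun do rewrite mulmxA XpX.
  by move=> /(cvg_unique _)/(_ (wX a)) ->.
exists (l *m pinvmx X), (fun t => w t - w t *m X *m pinvmx X) => i.
split=> [hi|wy].
  have iJ : i \in J by rewrite inE; apply/asboolP.
  rewrite -(enum_rankK_in iJ iJ); set a := enum_rank_in iJ i; split => [|t].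
    by under eq_fun do rewrite dotX; rewrite dotX lX; exact: wX.
  by rewrite dotX mulmxBl XpX subrr mxE.
pose c := (e i)^T.
have dotc (v : 'rV[R]_n) : dotprod v (e i) = (v *m c) 0 0.
  by rewrite mxE; apply: eq_bigr => j _; rewrite mxE.
have /cvgr_lt := @cvg_mulmx _ _ (fun t => w t *m X) l (pinvmx X *m c) wX 0.
set L := (l *m _) 0 0; move=> /(_ (L + 1)); rewrite ltrDl ltr01 => /(_ isT) ub.
move/cvgry_gt : wy => /(_ (L + 1)) lb.
apply: filterS2 ub lb => t; rewrite !dotc mulmxBl => ub lb.
rewrite [X in _ < X]mxE [X in _ + X]mxE subr_gt0.
by apply: (lt_trans _ lb); rewrite -[_ *m pinvmx X *m c]mulmxA.
Qed.

End UltrafilterLimits.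

Section PrincipalPartsAtInfinity.
Context {R : realType} {n p : nat}.
Implicit Types (F : 'I_p -> mpoly n R) (x q s w : 'rV[R]_n) (k : multinom n).

Lemma dotprod_exponent_sub u k k' :
  dotprod u (exponent_vec k - exponent_vec k' : 'rV[R]_n) =
  exponent_dot u k - exponent_dot u k'.
Proof.
rewrite !exponent_dotE -sumrB; apply: eq_bigr => j _.
by rewrite !mxE mulrBr.
Qed.

Definition log_point x : 'rV[R]_n := \row_j ln `|x 0 j|.

(** A small diagonal shift leaves the coordinate hyperplanes, at the cost of
    enlarging the level. *)
Lemma generic_unbounded F (M : R) :
  (forall B : R, exists2 x : 'rV[R]_n, (forall i, polyfun (F i) x <= M) &
     exists j, B < `|x 0 j|) ->
  forall B : R, exists x : 'rV[R]_n, [/\ forall j, x 0 j != 0,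
     forall i, polyfun (F i) x <= M + 1 & exists j, B < `|x 0 j|].
Proof.
move=> unb B; have [x xM [j0 xB]] := unb (B + 1).
pose d : 'rV[R]_n := const_mx 1.
have coord_neq0 j : \forall s \near (0:R)^'+, (x + s *: d) 0 j != 0.
  have := @affine_neq0_near R (x 0 j) 1; rewrite oner_eq0 orbT => /(_ isT).
  by apply: filterS => s; rewrite !mxE.
have leM i : \forall s \near (0:R)^'+, polyfun (F i) (x + s *: d) <= M + 1.
  have /(@polyfun_line_lt0 _ _ _ _ d) : polyfun (F i - mpolyC n (M + 1)) x < 0.
    by rewrite /polyfun mevalB mevalC subr_lt0 (le_lt_trans (xM i))// ltrDl.
  by apply: filterS => s; rewrite /polyfun mevalB mevalC subr_lt0 => /ltW.
have big : \forall s \near (0:R)^'+, B < `|(x + s *: d) 0 j0|.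
  near=> s; rewrite !mxE mulr1.
  have s0 : 0 < s by [].
  have s1 : s < 1 by near: s; exact: nbhs_right_lt.
  have := ler_normB (x 0 j0 + s) s; rewrite addrK (gtr0_norm s0); lra.
have [s [? []]] : exists s : R, (forall j, (x + s *: d) 0 j != 0) /\
    (forall i, polyfun (F i) (x + s *: d) <= M + 1) /\ B < `|(x + s *: d) 0 j0|.
  apply: (@filter_ex _ (0:R)^'+); apply: filterI; first exact: filter_forall coord_neq0.
  by apply: filterI => //; exact: filter_forall leM.
by exists (x + s *: d); split=> //; exists j0.
Unshelve. all: by end_near. Qed.

(** A single coordinate escapes along [U]: if each were bounded on some set of
    [U], they would all be bounded on one, as there are finitely many. *)
Lemma ultrafilter_at_infinity (A : set 'rV[R]_n) :
  (forall B : R, exists2 x, A x & exists j, B < `|x 0 j|) ->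
  exists (U : set_system 'rV[R]_n) (j : 'I_n), [/\ UltraFilter U, U A &
    `|x 0 j| @[x --> U] --> +oo].
Proof.
move=> unb.
pose base (B : R) := [set x | A x /\ exists j, B < `|x 0 j|].
have base_proper : ProperFilter (filter_from setT base).
  apply: filter_from_proper; last first.
    by move=> B _; have [x Ax xB] := unb B; exists x.
  apply: filter_from_filter; first by exists 0.
  move=> B C _ _; exists (Num.max B C) => // x [Ax [j]].
  by rewrite gt_max => /andP[? ?]; split; split => //; exists j.
have [U [UU sub]] := ultraFilterLemma base_proper.
have Ubase B : U (base B) by apply: sub; exists B.
suff [j Uj] : exists j, forall B : R, U [set x : 'rV[R]_n | B < `|x 0 j|].
  exists U, j; split=> //; first by apply: filterS (Ubase 0) => x [].
  by apply/cvgryPgt.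
apply: contrapT => /forallNP noj.
have /choice[B hB] : forall j, exists B : R, U [set x : 'rV[R]_n | `|x 0 j| <= B].
  move=> j; have /existsNP[B nB] := noj j; exists B.
  have [//|] := in_ultra_setVsetC [set x : 'rV[R]_n | B < `|x 0 j|] UU.
  by apply: filterS => x /= /negP; rewrite -leNgt.
have {}hB : U [set x : 'rV[R]_n | forall j, `|x 0 j| <= B j] by exact: filter_forall hB.
have [x [[_ [j xj]] xB]] := filter_ex (filterI (Ubase (\sum_j `|B j|)) hB).
have := lt_le_trans xj (xB j); rewrite ltNge => /negP; apply.
by rewrite (bigD1 j)//= (le_trans (ler_norm _))// lerDl sumr_ge0.
Qed.

Lemma ultra_signs (U : set_system 'rV[R]_n) (UU : UltraFilter U) :
  U [set x : 'rV[R]_n | forall j, x 0 j != 0] ->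
  exists2 s : 'rV[R]_n, (forall j, s 0 j != 0) &
    \forall x \near U, x = exp_point s (log_point x).
Proof.
move=> U0.
pose s : 'rV[R]_n := \row_j (if `[< U [set x : 'rV[R]_n | 0 < x 0 j] >] then 1 else -1).
exists s => [j|]; first by rewrite mxE; case: ifP; rewrite ?oppr_eq0 oner_eq0.
have sP j : U [set x : 'rV[R]_n | x 0 j != 0 -> x 0 j = s 0 j * expR (ln `|x 0 j|)].
  rewrite mxE; case: asboolP => [|nU].
    by apply: filterS => x x0 _; rewrite mul1r gtr0_norm ?lnK.
  have [//|] := in_ultra_setVsetC [set x : 'rV[R]_n | 0 < x 0 j] UU.
  apply: filterS => x /= /negP; rewrite -leNgt => xle0 xneq0.
  by rewrite mulN1r lnK ?ler0_norm ?opprK// posrE oppr_gt0 lt_neqAle xneq0.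
have {}sP : U [set x : 'rV[R]_n |
    forall j, x 0 j != 0 -> x 0 j = s 0 j * expR (ln `|x 0 j|)].
  exact: filter_forall sP.
apply: filterS2 U0 sP => x x0 xs.
by apply/rowP => j; rewrite [RHS]mxE [X in expR X]mxE -xs.
Qed.


Definition grows_faster (U : set_system 'rV[R]_n) k k' :=
  exponent_dot (log_point x) k - exponent_dot (log_point x) k' @[x --> U] --> +oo.

(** The split is applied to all differences of exponents in [K]; then [q] is the
    opposite of the divergent part at one point where all the finitely many
    dominations are visible.  The last two clauses are converses, obtained from
    the trichotomy. *)
Lemma limiting_weight (U : set_system 'rV[R]_n) (UU : UltraFilter U)
    (K : seq (multinom n)) :
  exists (winf q : 'rV[R]_n), forall k k', k \in K -> k' \in K ->
   [/\ grows_faster U k k' -> exponent_dot q k < exponent_dot q k',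
       exponent_dot q k = exponent_dot q k' ->
         exponent_dot (log_point x) k - exponent_dot (log_point x) k' @[x --> U] -->
         exponent_dot winf k - exponent_dot winf k' &
       exponent_dot q k' < exponent_dot q k ->
         exponent_dot (log_point x) k - exponent_dot (log_point x) k' @[x --> U] --> -oo].
Proof.
pose e (i : seq_sub K * seq_sub K) : 'rV[R]_n :=
  exponent_vec (val i.1) - exponent_vec (val i.2).
have [winf [u hu]] := ultra_split (U := U) e log_point.
have pos_pairs : U [set x | forall i,
    dotprod (log_point y) (e i) @[y --> U] --> +oo -> 0 < dotprod (u x) (e i)].
  apply: filter_forall => i.
  have [iy|niy] := pselect (dotprod (log_point y) (e i) @[y --> U] --> +oo).
    by apply: filterS ((hu i).2 iy).
  by apply: filterS (filterT : U setT).
have [x xpos] := filter_ex pos_pairs.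
exists winf, (- u x).
have qE k : exponent_dot (- u x) k = - exponent_dot (u x) k.
  by rewrite !exponent_dotE -sumrN; apply: eq_bigr => j _; rewrite mxE mulNr.
have faster k k' : k \in K -> k' \in K ->
    grows_faster U k k' -> exponent_dot (- u x) k < exponent_dot (- u x) k'.
  move=> kK kK' kk'; rewrite !qE ltrN2 -subr_gt0 -dotprod_exponent_sub.
  apply: (xpos (SeqSub kK, SeqSub kK')) => /=.
  by under eq_fun do rewrite dotprod_exponent_sub; exact: kk'.
have slower k k' : exponent_dot (log_point x) k - exponent_dot (log_point x) k'
    @[x --> U] --> -oo -> grows_faster U k' k.
  move=> kNy; apply/cvgNrNy; apply: cvg_trans kNy; apply: near_eq_cvg.
  by near=> y; rewrite /= opprB.
have conv k k' : k \in K -> k' \in K ->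
    (exists l : R, exponent_dot (log_point x) k - exponent_dot (log_point x) k'
      @[x --> U] --> l) ->
    exponent_dot (- u x) k = exponent_dot (- u x) k' /\
    exponent_dot (log_point x) k - exponent_dot (log_point x) k' @[x --> U] -->
         exponent_dot winf k - exponent_dot winf k'.
  move=> kK kK' [l hl].
  have [] := (hu (SeqSub kK, SeqSub kK')).1 => /=.
    by exists l; under eq_fun do rewrite dotprod_exponent_sub.
  rewrite dotprod_exponent_sub; under eq_fun do rewrite dotprod_exponent_sub.
  move=> lim /(_ x); rewrite dotprod_exponent_sub => /eqP.
  by rewrite subr_eq0 => /eqP e0; rewrite !qE e0.
move=> k k' kK kK'; split=> [|qeq|qlt]; first exact: faster.
- have [hl|hy|hNy] := ultra_trichotomy
    (fun x => exponent_dot (log_point x) k - exponent_dot (log_point x) k') (U := U).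
  + by have [] := conv k k' kK kK' hl.
  + by have := faster _ _ kK kK' hy; rewrite qeq ltxx.
  + by have := faster _ _ kK' kK (slower _ _ hNy); rewrite qeq ltxx.
- have [hl|hy|//] := ultra_trichotomy
    (fun x => exponent_dot (log_point x) k - exponent_dot (log_point x) k') (U := U).
  + by have [qeq _] := conv k k' kK kK' hl; rewrite qeq ltxx in qlt.
  + by have := lt_trans (faster _ _ kK kK' hy) qlt; rewrite ltxx.
Unshelve. all: by end_near. Qed.

End PrincipalPartsAtInfinity.

(** * Coercivity *)

Section Coercivity.
Context {R : realType} {n p : nat}.
Implicit Types (F : 'I_p -> mpoly n R) (x q s w : 'rV[R]_n) (k : multinom n).

Lemma face_value_attained h q k0 : k0 \in msupp h ->
  exists2 k, k \in msupp h & face_value q (@newton_polyhedron R n h) = exponent_dot q k.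
Proof.
move=> k0h.
have [k kh kmin] : exists2 k, k \in msupp h &
    forall k', k' \in msupp h -> exponent_dot q k <= exponent_dot q k'.
  elim: (msupp h : seq _) k0 k0h => // a r IH k0 _.
  case: r IH => [|b r] IH.
    by exists a; rewrite ?mem_head// => k'; rewrite inE => /eqP ->.
  have [k kr kmin] := IH b (mem_head _ _).
  have [ak|ka] := leP (exponent_dot q a) (exponent_dot q k).
    exists a; first exact: mem_head.
    by move=> k'; rewrite inE => /orP[/eqP -> //|/kmin]; exact: le_trans.
  exists k; first by rewrite inE kr orbT.
  by move=> k'; rewrite inE => /orP[/eqP ->|/kmin//]; exact: ltW.
by exists k => //; exact: face_value_min.
Qed.

(** By convenience, [F i] has a pure power of a coordinate that tends to infinity,
    so its dominant monomial tends to infinity; as [F i] stays bounded above,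
    its quotient by that monomial has a nonpositive limit. *)
Lemma unbounded_principal_parts F (M : R) : convenient F ->
  (forall B : R, exists2 x : 'rV[R]_n, (forall i, polyfun (F i) x <= M) &
     exists j, B < `|x 0 j|) ->
  exists q x : 'rV[R]_n, [/\ forall j, x 0 j != 0,
    forall i, face_value q (newton_polyhedron (F i)) < 0 &
    forall i, polyfun (principal_part q (F i)) x <= 0].
Proof.
move=> Fconv unb.
pose A : set 'rV[R]_n := [set x : 'rV[R]_n | (forall j, x 0 j != 0) /\
  forall i, polyfun (F i) x <= M + 1].
have [|U [j0 [UU UA Uj0]]] := @ultrafilter_at_infinity R n A.
  move=> B; have [x [x0 xM xB]] := generic_unbounded unb B.
  by exists x.
have U0 : U [set x : 'rV[R]_n | forall j, x 0 j != 0].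
  by apply: filterS UA => x [].
have [s s0 Us] := ultra_signs UU U0.
(* The zero exponent is included to compare monomials with constants. *)
pose K := (@mnm0 n) :: flatten [seq (msupp (F i) : seq _) | i <- enum 'I_p].
have K0 : (@mnm0 n) \in K by exact: mem_head.
have suppK i k : k \in msupp (F i) -> k \in K.
  by move=> ki; rewrite inE; apply/orP; right; apply/flatten_mapP; exists i;
    rewrite ?mem_enum.
have [winf [q wq]] := limiting_weight UU K.
have dot0 u : exponent_dot u (@mnm0 n) = 0 :> R.
  by rewrite exponent_dotE big1// => j _; rewrite mnm0E mulr0.
have Ui i : exists k, [/\ k \in msupp (F i),
    face_value q (newton_polyhedron (F i)) = exponent_dot q k & exponent_dot q k < 0].
  have [kj [kji kj0 kj_axis]] := convenient_polyP (Fconv i) j0.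
  have kj_neg : exponent_dot q kj < 0.
    rewrite -(dot0 q).
    have [-> //] := wq kj (@mnm0 n) (suppK _ _ kji) K0.
    apply/cvgryPgt => B.
    have /cvgryPgt/(_ (expR `|B|)) UB := Uj0.
    rewrite nearE; apply: (@filterS _ U _ _ _ _ UB) => x xB.
    rewrite dot0 subr0 exponent_dotE (bigD1 j0)//= big1 ?addr0 ?mxE; last first.
      by move=> l lj0; rewrite kj_axis ?mulr0.
    have lnB : `|B| < ln `|x 0 j0|.
      by rewrite -ltr_expR lnK// posrE (lt_trans _ xB)// expR_gt0.
    rewrite (le_lt_trans (ler_norm B))// (lt_le_trans lnB)//.
    by rewrite ler_peMr ?ler1n// (le_trans _ (ltW lnB)).
  have [k ki kE] := face_value_attained q kji.
  by exists k; split; rewrite // -kE (le_lt_trans (face_value_le _ kji)).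
exists q, (exp_point s winf); split.
- by move=> j; rewrite mxE mulf_neq0// gt_eqF// expR_gt0.
- by move=> i; have [k [_ -> ]] := Ui i.
move=> i; have [k [ki dE k_neg]] := Ui i.
pose v x := exponent_dot (log_point x) k.
have vy : v @ U --> +oo.
  have [_ _] := wq (@mnm0 n) k K0 (suppK _ _ ki); rewrite dot0 => /(_ k_neg).
  under eq_fun do rewrite dot0 sub0r.
  by move=> h; apply/cvgNrNy.
have lim : polyfun (F i) (exp_point s (log_point x)) * expR (- v x) @[x --> U] -->
    polyfun (principal_part q (F i)) (exp_point s winf) * expR (- exponent_dot winf k).
  rewrite principal_partE mulr_suml.
  rewrite (eq_bigr (fun k' => mcoeff k' (F i) * monom k' s *
      expR (exponent_dot winf k' - exponent_dot winf k))); last first.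
    by move=> k' _; rewrite monom_exp_point expRD !mulrA.
  apply: polyfun_exp_point_cvg => k' k'i; rewrite dE => hk'.
    by have [_ + _] := wq k' k (suppK _ _ k'i) (suppK _ _ ki); apply; exact/eqP.
  have [_ _] := wq k' k (suppK _ _ k'i) (suppK _ _ ki); apply.
  by rewrite lt_neqAle eq_sym hk' -dE face_value_le.
have lim0 : (M + 1) * expR (- v x) @[x --> U] --> 0.
  rewrite -(mulr0 (M + 1)); apply: cvgM; first exact: cvg_cst.
  by apply: (cvg_comp v (fun r => expR (- r)) vy); exact: cvgr_expR.
have := ler_cvg_to lim lim0; rewrite pmulr_lle0 ?expR_gt0//; apply.
apply: filterS2 Us UA => x xs [_ xM].
by rewrite -xs ler_wpM2r ?expR_ge0.
Qed.

(** If the sublevel set were unbounded, there would be a curve along which all the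
    [F i] tend to minus infinity. *)
Lemma bounded_below_sublevel_bounded F (M N : R) :
  convenient F -> nondegenerate_at_infinity F ->
  (forall x, exists i, N < polyfun (F i) x) ->
  exists B : R, forall x, (forall i, polyfun (F i) x <= M) -> forall j, `|x 0 j| <= B.
Proof.
move=> Fconv ndeg lb; apply: contrapT => /forallNP nB.
have [|q [x [x0 q0 le0]]] := unbounded_principal_parts (M := M) Fconv.
  move=> B; have /existsNP[x /not_implyP[xM /existsNP[j /negP xj]]] := nB B.
  by exists x => //; exists j; rewrite ltNge.
have [y y0 lt0] := principal_parts_lt0 ndeg q0 x0 le0.
have curve : \forall s \near +oo, forall i, polyfun (F i) (exp_point y (- s *: q)) <= N.
  apply: filter_forall => i; exact: polyfun_curve_Ny.
have [t tN] := filter_ex curve.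
have [i] := lb (exp_point y (- t *: q)); rewrite ltNge => /negP; apply.
exact: tN.
Qed.

End Coercivity.

(** * The value function is algebraic *)

Section ValueFormula.
Context {R : realType} {n : nat}.
Implicit Types (h : mpoly n R) (k : multinom n) (x : 'rV[R]_n) (e : seq R).

(** Quantifying over all the variables in [s] amounts to choosing an environment
    that is arbitrary on [s] and unchanged elsewhere. *)
Lemma holds_foldr_Exists (phi : ord.formula R) (s : seq nat) e :
  ord.holds e (foldr (@ord.Exists R) phi s) <->
  exists e', (forall i, i \notin s -> nth 0 e' i = nth 0 e i) /\ ord.holds e' phi.
Proof.
elim: s e => [|i s IH] e /=.
  split=> [he|[e' [ee' he']]]; first by exists e.
  by apply: ord.eq_holds he' => i; rewrite ee'.
split=> [[z /IH[e' [ee' he']]]|[e' [ee' he']]].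
  exists e'; split=> // j; rewrite inE negb_or => /andP[ji js].
  by rewrite ee'// nth_set_nth /= (negbTE ji).
exists (nth 0 e' i); apply/IH; exists e'; split=> // j js.
rewrite nth_set_nth /=; case: (eqVneq j i) => [->//|ji].
by rewrite ee'// inE negb_or ji.
Qed.

Lemma holds_foldr_And e (s : seq (ord.formula R)) (phi : ord.formula R) :
  ord.holds e (foldr (@ord.And R) phi s) <->
  (forall i, (i < size s)%N -> ord.holds e (nth phi s i)) /\ ord.holds e phi.
Proof.
elim: s => [|psi s IH] /=; first by split=> [|[]].
rewrite IH; split=> [[h [hs hphi]]|[hs hphi]].
  by split=> // -[|i] //= /hs.
split; first exact: (hs 0%N).
by split=> // i; exact: (hs i.+1).
Qed.

Definition monom_term k : GRing.term R :=
  foldr (fun j t => GRing.Mul (GRing.Exp (GRing.Var R (j : 'I_n).+2) (k j)) t)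
    (GRing.Const 1) (enum 'I_n).

Definition poly_term h : GRing.term R :=
  foldr (fun k t => GRing.Add (GRing.Mul (GRing.Const (mcoeff k h)) (monom_term k)) t)
    (GRing.Const 0) (msupp h).

Lemma rterm_poly_term h : GRing.rterm (poly_term h).
Proof.
rewrite /poly_term; elim: (msupp h : seq _) => //= k s ->; rewrite andbT.
by rewrite /monom_term; elim: (enum 'I_n).
Qed.

Lemma eval_poly_term h e :
  GRing.eval e (poly_term h) = polyfun h (\row_j nth 0 e j.+2).
Proof.
rewrite polyfunE /poly_term; elim: (msupp h : seq _) => /= [|k s ->].
  by rewrite big_nil.
rewrite big_cons; congr (_ * _ + _).
rewrite /monom_term /monom -[index_enum _]enumT.
elim: (enum 'I_n) => /= [|j r ->]; first by rewrite big_nil.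
by rewrite big_cons mxE.
Qed.

(** Variable 0 is the level of the constraints, variable 1 the level of the
    objective, and variables [2 .. n + 1] are the coordinates of the point. *)
Definition value_formula m (f : mpoly n R) (g : 'I_m -> mpoly n R) : ord.formula R :=
  foldr (@ord.Exists R)
    (foldr (@ord.And R) (ord.Le (poly_term f) (GRing.Var R 1))
       [seq ord.Le (poly_term (g i)) (GRing.Var R 0) | i <- enum 'I_m])
    (iota 2 n).

Lemma rformula_value_formula m f (g : 'I_m -> mpoly n R) :
  ord.rformula (value_formula f g).
Proof.
rewrite /value_formula; elim: (iota 2 n) => //=.
by elim: (enum 'I_m) => [|i s] /=; rewrite rterm_poly_term.
Qed.

Lemma holds_value_formula m f (g : 'I_m -> mpoly n R) t y :
  ord.holds [:: t; y] (value_formula f g) <->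
  exists2 x, sublevel g t x & polyfun f x <= y.
Proof.
rewrite /value_formula holds_foldr_Exists; split.
  case=> e' [ee' /holds_foldr_And[/=]]; rewrite size_map eval_poly_term => hg.
  have e0 : nth 0 e' 0 = t by rewrite ee'// mem_iota.
  have e1 : nth 0 e' 1 = y by rewrite ee'// mem_iota.
  rewrite e1 => hf; exists (\row_j nth 0 e' j.+2) => // i.
  have ii : (index i (enum 'I_m) < size (enum 'I_m))%N by rewrite index_mem mem_enum.
  by have := hg _ ii; rewrite (nth_map i)//= nth_index ?mem_enum//= eval_poly_term e0.
case=> x xg xf; pose e' := [:: t, y & [seq x 0 j | j <- enum 'I_n]].
have e'x : \row_(j < n) nth 0 e' j.+2 = x.
  apply/rowP => j; rewrite mxE /= (nth_map j) ?size_enum_ord//.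
  by rewrite nth_ord_enum.
exists e'; split=> [i|].
  rewrite mem_iota; case: i => [//|[//|i]].
  rewrite /= addSn addSn !ltnS add0n -leqNgt => ni.
  by rewrite !nth_default// size_map size_enum_ord.
apply/holds_foldr_And; split; last by rewrite /= eval_poly_term e'x.
move=> i; rewrite size_map => ii.
have j0 : 'I_m by move: ii; rewrite size_enum_ord => /Ordinal.
by rewrite (nth_map j0)//= eval_poly_term e'x.
Qed.

End ValueFormula.

Section QuantifierFreeSets.
Context {R : realType}.
Implicit Types (P : {poly {poly R}}) (t y : R).

Lemma bivariate_of_term (tau : GRing.term R) : GRing.rterm tau ->
  exists P, forall t y, GRing.eval [:: t; y] tau = P.[y%:P].[t].
Proof.
elim: tau => //=.
- case=> [|[|i]] _.
  + by exists ('X%:P) => t y; rewrite !hornerE.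
  + by exists 'X => t y; rewrite !hornerE.
  + by exists 0 => t y; rewrite !hornerE /= nth_nil.
- by move=> c _; exists (c%:P%:P) => t y; rewrite !hornerE.
- by move=> k _; exists (k%:R%:P%:P) => t y; rewrite !hornerE.
- move=> t1 IH1 t2 IH2 /andP[/IH1[P1 e1] /IH2[P2 e2]].
  by exists (P1 + P2) => t y; rewrite e1 e2 !hornerE.
- by move=> t1 IH1 /IH1[P1 e1]; exists (- P1) => t y; rewrite e1 !hornerE.
- by move=> t1 IH1 k /IH1[P1 e1]; exists (P1 *+ k) => t y; rewrite e1 !hornerMn.
- move=> t1 IH1 t2 IH2 /andP[/IH1[P1 e1] /IH2[P2 e2]].
  by exists (P1 * P2) => t y; rewrite e1 e2 !hornerM.
- by move=> t1 IH1 k /IH1[P1 e1]; exists (P1 ^+ k) => t y; rewrite e1 !horner_exp.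
Qed.

Lemma bivariate_continuous P t : continuous (fun y => P.[y%:P].[t]).
Proof.
have -> : (fun y => P.[y%:P].[t]) = horner (map_poly (horner_eval t) P).
  by apply/funext => y; rewrite -[y in RHS](hornerC y t) horner_map.
exact: continuous_horner.
Qed.

(** Near [y], for fixed [t], [b] can change only where one of finitely many plane
    curves passes through [(t, y)].  Excluding the zero polynomial is what makes
    the curves proper. *)
Definition locally_constant_off_curves (A : Type) (b : R -> R -> A) :=
  exists L : seq {poly {poly R}}, 0 \notin L /\
  forall t y, (forall Q, Q \in L -> Q.[y%:P].[t] != 0) ->
    \forall z \near y, b t z = b t y.

Lemma locally_constant_off_curves_op (A B C : Type) (op : A -> B -> C)
    (b1 : R -> R -> A) (b2 : R -> R -> B) :
  locally_constant_off_curves b1 -> locally_constant_off_curves b2 ->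
  locally_constant_off_curves (fun t y => op (b1 t y) (b2 t y)).
Proof.
move=> [L1 [L10 h1]] [L2 [L20 h2]]; exists (L1 ++ L2); split.
  by rewrite mem_cat negb_or L10.
move=> t y hL; have /h1 n1 : forall Q, Q \in L1 -> Q.[y%:P].[t] != 0.
  by move=> Q QL; apply: hL; rewrite mem_cat QL.
have /h2 n2 : forall Q, Q \in L2 -> Q.[y%:P].[t] != 0.
  by move=> Q QL; apply: hL; rewrite mem_cat QL orbT.
by apply: filterS2 n1 n2 => z -> ->.
Qed.

(** The list is empty for the zero polynomial, whose sign is constant; this is how
    zero polynomials are kept out of the list. *)
Lemma sign_stable P : locally_constant_off_curves (fun t y => Num.sg P.[y%:P].[t]).
Proof.
have [->|P0] := eqVneq P 0.
  by exists [::]; split=> // t y _; near=> z; rewrite !horner0.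
exists [:: P]; split=> [|t y /(_ P (mem_head _ _)) Py0]; first by rewrite inE eq_sym.
have Pc := @bivariate_continuous P t y.
have [Py|Py] := ltP 0 P.[y%:P].[t].
  rewrite (gtr0_sg Py).
  by apply: filterS (cvgr_gt _ Pc _ Py) => z ?; rewrite gtr0_sg.
have {}Py : P.[y%:P].[t] < 0 by rewrite lt_neqAle Py0.
rewrite (ltr0_sg Py).
by apply: filterS (cvgr_lt _ Pc _ Py) => z ?; rewrite ltr0_sg.
Unshelve. all: by end_near. Qed.

Lemma qf_eval_locally_constant (phi : ord.formula R) :
  ord.qf_form phi -> ord.rformula phi ->
  locally_constant_off_curves (fun t y => ord.qf_eval [:: t; y] phi).
Proof.
have atom (r : R -> bool) (t1 t2 : GRing.term R) (b : R -> R -> bool) :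
    (forall t y, b t y =
      r (Num.sg (GRing.eval [:: t; y] t2 - GRing.eval [:: t; y] t1))) ->
    GRing.rterm t1 && GRing.rterm t2 -> locally_constant_off_curves b.
  move=> bE /andP[/bivariate_of_term[P1 e1] /bivariate_of_term[P2 e2]].
  have [L [L0 hL]] := sign_stable (P2 - P1).
  exists L; split=> // t y /hL; apply: filterS => z.
  by rewrite !hornerE !bE !e1 !e2 => ->.
elim: phi => //=.
- by move=> b _ _; exists [::]; split=> // t y _; near=> z.
- move=> t1 t2 _; apply: (atom (fun s => s == 0)) => t y.
  by rewrite sgr_eq0 subr_eq0 eq_sym.
- move=> t1 t2 _; apply: (atom (fun s => 0 < s)) => t y.
  by rewrite sgr_gt0 subr_gt0.
- move=> t1 t2 _; apply: (atom (fun s => 0 <= s)) => t y.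
  by rewrite sgr_ge0 subr_ge0.
- move=> p1 IH1 p2 IH2 /andP[q1 q2] /andP[r1 r2].
  exact: (locally_constant_off_curves_op andb (IH1 q1 r1) (IH2 q2 r2)).
- move=> p1 IH1 p2 IH2 /andP[q1 q2] /andP[r1 r2].
  exact: (locally_constant_off_curves_op orb (IH1 q1 r1) (IH2 q2 r2)).
- move=> p1 IH1 p2 IH2 /andP[q1 q2] /andP[r1 r2].
  exact: (locally_constant_off_curves_op implb (IH1 q1 r1) (IH2 q2 r2)).
- move=> p1 IH1 q1 r1.
  exact: (locally_constant_off_curves_op (fun b _ => ~~ b) (IH1 q1 r1) (IH1 q1 r1)).
Unshelve. all: by end_near. Qed.

End QuantifierFreeSets.

(** By quantifier elimination, the epigraph [{(t, y) | exists x, g x <= t, f x <= y}]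
    is described by finitely many polynomials in [(t, y)].  The infimum [mu] is a
    boundary point of the fibre over [t], so one of the nonzero polynomials of
    the description vanishes at [(t, mu)]; [P] is their product. *)
Lemma value_function_algebraic {R : realType} n m (f : mpoly n R)
    (g : 'I_m -> mpoly n R) :
  exists2 P : {poly {poly R}}, P != 0 & forall t mu : R,
    (forall y, mu < y -> exists2 x, sublevel g t x & polyfun f x <= y) ->
    (forall x, sublevel g t x -> mu <= polyfun f x) ->
    P.[mu%:P].[t] = 0.
Proof.
pose qe (i : nat) (bc : seq (GRing.term R) * seq (GRing.term R)) : ord.formula R :=
  qe_rcf.qfr_to_formula (qe_rcf.wproj i bc).
pose phi := ord.quantifier_elim qe (value_formula f g).
have rphi := rformula_value_formula f g.
have /andP[qf rf] : ord.qf_form phi && ord.rformula phi.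
  by apply: ord.quantifier_elim_wf rphi; exact: (@qe_rcf.wf_QE_wproj R).
have phiP t y : reflect (exists2 x, sublevel g t x & polyfun f x <= y)
    (ord.qf_eval [:: t; y] phi).
  apply: (equivP (ord.quantifier_elim_rformP _ _ _ rphi)).
  - exact: (@qe_rcf.wf_QE_wproj R).
  - exact: (@qe_rcf.valid_QE_wproj R).
  - exact: holds_value_formula.
have [L [L0 hL]] := qf_eval_locally_constant qf rf.
exists (\prod_(Q <- L) Q).
  rewrite prodf_seq_neq0; apply/allP => Q QL /=.
  by apply: contraNneq L0 => <-.
move=> t mu above below; apply: contrapT => prod0.
have /hL/nbhs_ballP[e e0 eb] : forall Q, Q \in L -> Q.[mu%:P].[t] != 0.
  move=> Q QL; apply/eqP => Q0; apply: prod0.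
  by rewrite (big_rem Q QL) /= !hornerM Q0 mul0r.
(* The truth value is constant near [mu], but differs on its two sides. *)
have yes : ord.qf_eval [:: t; mu + e / 2] phi.
  by apply/phiP/above; rewrite ltrDl divr_gt0.
have no : ~~ ord.qf_eval [:: t; mu - e / 2] phi.
  apply/negP => /phiP[x /below le1 le2].
  by have := le_trans le1 le2; rewrite leNgt gtrDl oppr_lt0 divr_gt0.
have e2 : `|e / 2| < e.
  by rewrite gtr0_norm ?divr_gt0// ltr_pdivrMr// ltr_pMr// ltr1n.
move: yes no; rewrite !eb => [->//||]; rewrite /= /ball /=.
  by rewrite subKr.
by rewrite opprD addrA subrr sub0r normrN.
Qed.

(** * Growth of algebraic functions at zero and at infinity *)

Section RootGrowth.
Context {R : realType}.
Implicit Types (P Q S : {poly {poly R}}) (p : {poly R}) (t y h : R).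

Lemma horner_pow_bound p t : 1 <= t ->
  `|p.[t]| <= (\sum_(i < size p) `|p`_i|) * t ^+ size p.
Proof.
move=> t1; have t0 : 0 <= t by rewrite (le_trans ler01).
rewrite horner_coef mulr_suml (le_trans (ler_norm_sum _ _ _))//.
apply: ler_sum => i _; rewrite normrM normrX (ger0_norm t0) ler_wpM2l//.
by rewrite ler_weXn2l// ltnW.
Qed.

Lemma horner_unit_bound p t : 0 <= t <= 1 -> `|p.[t]| <= \sum_(i < size p) `|p`_i|.
Proof.
move=> /andP[t0 t1]; rewrite horner_coef (le_trans (ler_norm_sum _ _ _))//.
apply: ler_sum => i _; rewrite normrM normrX (ger0_norm t0).
by rewrite ler_piMr// exprn_ile1.
Qed.

Lemma bivariate_unit_bound S : exists2 K : R, 0 < K &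
  forall t h, 0 <= t <= 1 -> 0 <= h <= 1 -> `|S.[t%:P].[h]| <= K.
Proof.
exists (\sum_(i < size S) \sum_(j < size S`_i) `|S`_i`_j| + 1).
  by rewrite ltr_wpDl ?ltr01//; apply: sumr_ge0 => i _; exact: sumr_ge0.
move=> t h ht hh; have /andP[t0 t1] := ht.
rewrite [S.[_]]horner_coef horner_sum ler_wpDr ?ler01//.
rewrite (le_trans (ler_norm_sum _ _ _))//; apply: ler_sum => i _.
rewrite -rmorphXn /= hornerM hornerC normrM normrX (ger0_norm t0).
rewrite (le_trans _ (horner_unit_bound _ hh))//.
by rewrite ler_piMr// exprn_ile1.
Qed.

Lemma poly_eventually_away p : p != 0 ->
  exists2 c : R, 0 < c & exists T, forall t, T <= t -> c <= `|p.[t]|.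
Proof.
move=> p0; exists `|lead_coef p|; first by rewrite normr_gt0 lead_coef_eq0.
have [lp|lp] := ltP 0 (lead_coef p).
  have [T hT] := polyrcf.poly_pinfty_gt_lc lp; exists T => t /hT pt.
  by rewrite !ger0_norm ?(ltW lp)// (le_trans _ pt)// ltW.
have {}lp : 0 < lead_coef (- p).
  by rewrite lead_coefN oppr_gt0 lt_neqAle lead_coef_eq0 p0.
have [T hT] := polyrcf.poly_pinfty_gt_lc lp; exists T => t /hT pt.
rewrite -normrN -lead_coefN -[X in _ <= X]normrN -hornerN.
by rewrite !ger0_norm ?(ltW lp)// (le_trans _ pt)// ltW.
Qed.

(** Cauchy's bound on the roots of [P (t, .)]: for large [t], the leading
    coefficient stays away from zero and the others grow polynomially. *)
Lemma root_growth_infty P : P != 0 ->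
  exists T C (N : nat), [/\ 1 <= T, 0 <= C & forall t y, T <= t ->
    P.[y%:P].[t] = 0 -> `|y| <= C * t ^+ N].
Proof.
move=> P0; pose a := lead_coef P.
have a0 : a != 0 by rewrite lead_coef_eq0.
have [c c0 [T hT]] := poly_eventually_away a0.
pose N := (\sum_(i < size P) size (P`_i)%R)%N.
pose B i : R := \sum_(j < size P`_i) `|P`_i`_j|.
have B0 i : 0 <= B i by apply: sumr_ge0.
exists (Num.max 1 T), (1 + c^-1 * \sum_(i < size P) B i), N.
split=> [||t y]; first by rewrite le_max lexx.
  by rewrite addr_ge0// mulr_ge0 ?invr_ge0 ?(ltW c0)// sumr_ge0.
rewrite ge_max => /andP[t1 Tt] Pty.
pose Pt := map_poly (horner_eval t) P.
have at0 : horner_eval t a != 0.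
  by rewrite /horner_eval -normr_gt0 (lt_le_trans c0)// hT.
have szPt : size Pt = size P by rewrite size_map_poly_id0.
have lcPt : lead_coef Pt = a.[t] by rewrite lead_coef_map_eq.
have Pt0 : Pt != 0 by rewrite -size_poly_eq0 szPt size_poly_eq0.
have Pty0 : Pt.[y] = 0 by rewrite -Pty -[y in LHS](hornerC y t) horner_map.
have := polyrcf.cauchy_boundP Pt0 Pty0; rewrite /polyrcf.cauchy_bound lcPt szPt.
move=> /ltW /le_trans; apply; rewrite mulrDl mul1r lerD//; first exact: exprn_ege1.
rewrite -mulrA; apply: ler_pM; rewrite ?invr_ge0 ?normr_ge0 ?sumr_ge0//.
  by rewrite lef_pV2 ?posrE// ?hT// (lt_le_trans c0)// hT.
rewrite mulr_suml; apply: ler_sum => i _.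
rewrite coef_map /= (le_trans (horner_pow_bound _ t1))// ler_wpM2l ?sumr_ge0//.
by rewrite ler_weXn2l// /N (bigD1 i)//= leq_addr.
Qed.

(** After division by a power of [t], [Q (t, h) = h ^ b * r' h + t * S2 (t, h)]
    with [r' 0 <> 0], so [h ^ b] is at most a multiple of [t].  The exponent is
    raised to [b.+1] to make it positive in all cases. *)
Lemma root_growth_zero Q : Q != 0 ->
  exists (e C : R) (b : nat), [/\ 0 < e <= 1, 0 < C & forall t h, 0 < t <= e ->
    0 <= h <= e -> Q.[h%:P].[t] = 0 -> h ^+ b.+1 <= C * t].
Proof.
move=> Q0.
(* [m] is the largest power of [t] that divides [Q]. *)
have [m [S]] := multiplicity_XsubC (swapXY Q) 0.
rewrite swapXY_eq0 Q0 /= => S0 QS.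
have Q_S t h : 0 < t -> Q.[h%:P].[t] = 0 -> S.[t%:P].[h] = 0.
  move=> t0; rewrite -horner2_swapXY QS hornerM horner_exp hornerXsubC.
  rewrite subr0 hornerM -rmorphXn hornerC => /eqP; rewrite mulf_eq0 expf_eq0.
  by rewrite (gt_eqF t0) andbF orbF => /eqP.
pose r := S.[0].
have [S2 S2E] : exists S2, S - r%:P = S2 * ('X - 0%:P).
  by apply/factor_theorem; rewrite /root hornerD hornerN hornerC subrr.
have [b [r' r'0 rE]] := multiplicity_XsubC r 0.
move: r'0; rewrite -[r == 0]/(root S 0) S0 /= => r'0.
pose c := `|r'.[0]| / 2.
have c0 : 0 < c by rewrite divr_gt0// normr_gt0.
have [d d0 hd] : exists2 d : R, 0 < d & forall h, `|h| < d -> c <= `|r'.[h]|.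
  have /(cvg_norm)/cvgr_gt/(_ c) := @continuous_horner R r' 0.
  rewrite ltr_pdivrMr// ltr_pMr ?normr_gt0// ltr1n => /(_ isT)/nbhs_ballP[d d0 hd].
  exists d => // h hd'; apply: ltW; apply: hd.
  by rewrite /ball /= sub0r normrN.
have [K K0 hK] := bivariate_unit_bound S2.
exists (Num.min 1 (d / 2)), (K / c), b; split.
- by rewrite lt_min ltr01 divr_gt0//= ge_min lexx.
- by rewrite divr_gt0.
move=> t h /andP[t0]; rewrite le_min => /andP[t1 td] /andP[h0].
rewrite le_min => /andP[h1 hd2] /(Q_S _ _ t0) Sth.
have := congr1 (fun s => s.[t%:P].[h]) S2E.
rewrite hornerD hornerN hornerC hornerM hornerXsubC hornerD hornerN Sth sub0r subr0.
rewrite hornerM hornerC rE hornerM horner_exp hornerXsubC subr0 => e.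
have := congr1 (fun z : R => `|z|) e; rewrite /= normrN !normrM normrX.
rewrite (ger0_norm h0) (gtr0_norm t0) => {}e.
have le1 : c * h ^+ b <= K * t.
  apply: (@le_trans _ _ (`|r'.[h]| * h ^+ b)).
    rewrite ler_wpM2r ?exprn_ge0// hd// ger0_norm// (le_lt_trans hd2)//.
    by rewrite ltr_pdivrMr// ltr_pMr// ltr1n.
  by rewrite e ler_wpM2r ?(ltW t0)// hK// ?h0 ?h1// (ltW t0).
rewrite -ler_pdivlMl// mulrA [_^-1 * K]mulrC in le1.
by apply: le_trans le1; rewrite exprS ler_piMl// exprn_ge0.
Qed.

Lemma powR_root_le (h C : R) (b : nat) : 0 <= h -> h ^+ b.+1 <= C ->
  h <= C `^ (b.+1%:R^-1).
Proof.
move=> h0 hC.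
have C0 : 0 <= C by rewrite (le_trans _ hC)// exprn_ge0.
have -> : h = (h ^+ b.+1) `^ (b.+1%:R^-1).
  by rewrite -powR_mulrn// -powRrM divff ?powRr1// pnatr_eq0.
by apply: ge0_ler_powR => //; rewrite ?invr_ge0// nnegrE ?exprn_ge0.
Qed.

(** [root_growth_zero] applies near [t = 0] because [mu t] tends to [fstar], and
    [root_growth_infty] for large [t]; on the compact interval in between,
    monotonicity bounds [fstar - mu t] by a constant multiple of [t `^ alpha]. *)
Lemma algebraic_holder_bound P (fstar : R) (mu : R -> R) : P != 0 ->
  (forall t, 0 < t -> P.[(mu t)%:P].[t] = 0) ->
  (forall t, 0 < t -> mu t <= fstar) ->
  (forall t u, 0 < t -> t <= u -> mu u <= mu t) ->
  (forall e, 0 < e -> exists2 d : R, 0 < d & forall t, 0 < t <= d -> fstar - e <= mu t) ->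
  exists alpha beta C : R, [/\ 0 < alpha, alpha <= 1 <= beta, 0 < C &
    forall t, 0 < t -> fstar - mu t <= C * (t `^ alpha + t `^ beta)].
Proof.
move=> P0 Pmu mu_le mu_mono mu_lim.
have [T [C2 [N [T1 C20 hinf]]]] := root_growth_infty P0.
(* [Q (t, h) = P (t, fstar - h)]. *)
pose Q := P \Po (fstar%:P%:P - 'X).
have Q0 : Q != 0.
  by rewrite comp_poly2_eq0// -opprB size_polyN size_XsubC.
have [e [C1 [b [/andP[e0 e1] C10 hzero]]]] := root_growth_zero Q0.
have [d d0 hd] := mu_lim e e0.
pose t1 := Num.min d e.
have t10 : 0 < t1 by rewrite lt_min d0.
pose alpha : R := b.+1%:R^-1.
have alpha0 : 0 < alpha by rewrite invr_gt0.
have alpha1 : alpha <= 1 by rewrite invf_le1// ler1n.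
pose A1 := C1 `^ alpha.
pose A2 := `|fstar| + C2.
pose A3 := (fstar - mu T) / t1 `^ alpha.
have T0 : 0 < T by rewrite (lt_le_trans ltr01).
have A1ge0 : 0 <= A1 by exact: powR_ge0.
have A2ge0 : 0 <= A2 by rewrite addr_ge0.
have A3ge0 : 0 <= A3 by rewrite divr_ge0 ?powR_ge0// subr_ge0 mu_le.
exists alpha, N.+1%:R, (A1 + A2 + A3 + 1); split.
- by [].
- by rewrite alpha1 ler1n.
- by rewrite ltr_wpDl ?ltr01// !addr_ge0.
move=> t t0.
have ta0 := powR_ge0 t alpha; have tb0 := powR_ge0 t N.+1%:R.
have [tt1|t1t] := leP t t1.
  have [td te] : t <= d /\ t <= e by move: tt1; rewrite le_min => /andP.
  have : fstar - mu t <= (C1 * t) `^ alpha.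
    apply: powR_root_le; first by rewrite subr_ge0 mu_le.
    apply: hzero; rewrite ?t0 ?subr_ge0 ?mu_le//=.
      by rewrite lerBlDr addrC -lerBlDr hd// t0.
    by rewrite horner_comp hornerD hornerN hornerX hornerC -polyCB subKr Pmu.
  rewrite powRM ?(ltW t0) ?(ltW C10)// -/A1 => le1.
  nra.
have [Tt|tT] := leP T t.
  have : fstar - mu t <= A2 * t `^ N.+1%:R.
    rewrite powR_mulrn ?(ltW t0)// (le_trans (ler_norm _))//.
    rewrite (le_trans (ler_normB _ _))// mulrDl lerD//.
      by rewrite ler_peMr// exprn_ege1// (le_trans T1).
    rewrite (le_trans (hinf _ _ Tt (Pmu _ t0)))// ler_wpM2l//.
    by rewrite ler_weXn2l// (le_trans T1).
  nra.
have : fstar - mu t <= A3 * t `^ alpha.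
  apply: (@le_trans _ _ (fstar - mu T)).
    by rewrite lerD2l lerN2 mu_mono// ltW.
  rewrite -[leLHS](@divfK _ (t1 `^ alpha)) ?gt_eqF ?powR_gt0//.
  rewrite ler_wpM2l// ge0_ler_powR// ?nnegrE ?(ltW t0) ?(ltW t10) ?(ltW alpha0)//.
  exact: ltW.
nra.
Qed.

End RootGrowth.

(** * Minimizers, the error bound and the exact penalty *)

Section PenaltyFunction.
Context {R : realType} {n m : nat}.
Context (f : mpoly n R) (g : 'I_m -> mpoly n R).
Implicit Types (x : 'rV[R]_n) (a c t : R).

Lemma cons_mapP (P : mpoly n R -> Prop) :
  (forall i, P (cons_map f g i)) <-> P f /\ forall i, P (g i).
Proof.
split=> [h|[hf hg] i].
  split=> [|i]; first by have := h ord0; rewrite /cons_map unlift_none.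
  by have := h (lift ord0 i); rewrite /cons_map liftK.
by rewrite /cons_map; case: unliftP.
Qed.

Lemma violation_ge0 x : 0 <= violation g x.
Proof. exact: bigmax_ge_id. Qed.

Lemma violation_le x t : 0 <= t -> violation g x <= t <-> sublevel g t x.
Proof.
move=> t0; split=> [/bigmax_leP[_ h] i|h]; first exact: h.
by apply/bigmax_leP; split=> // i _; exact: h.
Qed.

Lemma violation_eq0 x : (violation g x == 0) <-> feasible g x.
Proof.
by rewrite eq_le violation_ge0 andbT; exact: violation_le.
Qed.

Lemma violation_continuous : continuous (violation g).
Proof.
rewrite /violation; elim: (index_enum _) => [|i s IH] x.
  rewrite (_ : (fun x => _) = cst 0); first exact: cst_continuous.
  by apply/funext => y; rewrite big_nil.
rewrite (_ : (fun x => _) = fun x => Num.max (polyfun (g i) x)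
    (\big[Num.max/0]_(i <- s) polyfun (g i) x)); last first.
  by apply/funext => y; rewrite big_cons.
apply: continuous_max; last exact: IH.
exact: polyfun_continuous.
Qed.

Lemma sublevel_closed t a : closed (sublevel g t `&` [set x | polyfun f x <= a]).
Proof.
have closed_le_polyfun (h : mpoly n R) (b : R) : closed [set x | polyfun h x <= b].
  apply: (@closed_comp _ _ (polyfun h) [set y : R | y <= b]); last exact: closed_le.
  by move=> x _; exact: polyfun_continuous.
apply: closedI => //.
have -> : sublevel g t = \bigcap_(i in setT) [set x | polyfun (g i) x <= t].
  by apply/seteqP; split=> [x h i _|x h i]; exact: h.
exact: closed_bigI.
Qed.

Context (f_lbound : exists l : R, forall x, feasible g x -> l <= polyfun f x).
Context (Fconv : convenient (cons_map f g)).
Context (Fndeg : nondegenerate_at_infinity (cons_map f g)).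

Lemma sublevel_compact t a : compact (sublevel g t `&` [set x | polyfun f x <= a]).
Proof.
apply: bounded_closed_compact; last exact: sublevel_closed.
have [l hl] := f_lbound.
(* A point with all values at most [Num.min (l - 1) 0] would be feasible, with
   a value of [f] below its lower bound [l]. *)
have [|B hB] := bounded_below_sublevel_bounded (N := Num.min (l - 1) 0)
  (Num.max t a) Fconv Fndeg.
  move=> x; apply: contrapT => /forallNP low.
  have /(cons_mapP (fun h => polyfun h x <= Num.min (l - 1) 0))[fx gx] :
      forall i, polyfun (cons_map f g i) x <= Num.min (l - 1) 0.
    by move=> i; rewrite leNgt; apply/negP; exact: low.
  have /hl : feasible g x by move=> i; rewrite (le_trans (gx i))// ge_min lexx orbT.
  by move: fx; rewrite le_min => /andP[]; lra.
exists (Num.max 0 B); split; first exact: num_real.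
move=> C BC x [gx fx].
have /hB xB : forall i, polyfun (cons_map f g i) x <= Num.max t a.
  apply/(cons_mapP (fun h => polyfun h x <= Num.max t a)); split.
    by rewrite (le_trans fx)// le_max lexx orbT.
  by move=> i; rewrite (le_trans (gx i))// le_max lexx.
rewrite /Num.Def.normr/= mx_normrE; apply: bigmax_le => [|[i j] _].
  by rewrite (le_trans _ (ltW BC))// le_max lexx.
by rewrite ord1 (le_trans (xB j))// (le_trans _ (ltW BC))// le_max lexx orbT.
Qed.

Context (S_neq0 : feasible g !=set0).

Lemma feasible_sublevel t x : 0 <= t -> feasible g x -> sublevel g t x.
Proof. by move=> t0 gx i; rewrite (le_trans (gx i)). Qed.

Lemma sublevel_minimizer t : 0 <= t ->
  exists2 x, sublevel g t x & forall y, sublevel g t y -> polyfun f x <= polyfun f y.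
Proof.
move=> t0; have [x0 /(feasible_sublevel t0) x0t] := S_neq0.
have [||x /[!inE] -[xt _] xmin] := EVT_min_rV (f := polyfun f) _
  (@sublevel_compact t (polyfun f x0)).
- by exists x0; split=> /=.
- by apply: continuous_subspaceT; exact: polyfun_continuous.
exists x => // y yt; have [yx0|/ltW x0y] := leP (polyfun f y) (polyfun f x0).
  by apply: xmin; rewrite inE; split.
by apply: le_trans x0y; apply: xmin; rewrite inE; split=> /=.
Qed.

(** On the compact set of points of violation at most 1 and value at most
    [f xs - e], the violation is positive, hence bounded away from zero. *)
Lemma almost_feasible_value xs e :
  (forall y, feasible g y -> polyfun f xs <= polyfun f y) -> 0 < e ->
  exists2 d : R, 0 < d & forall x, sublevel g d x -> polyfun f xs - e <= polyfun f x.
Proof.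
move=> xs_min e0; pose K := sublevel g 1 `&` [set x | polyfun f x <= polyfun f xs - e].
have [[x0 x0K]|K0] := pselect (K !=set0); last first.
  exists 1 => // x x1; rewrite leNgt; apply/negP => /ltW xe.
  by apply: K0; exists x.
have [||x /[!inE] -[x1 xe] xmin] := EVT_min_rV (f := violation g) _
  (@sublevel_compact 1 (polyfun f xs - e)).
- by exists x0.
- by apply: continuous_subspaceT; exact: violation_continuous.
have vx0 : 0 < violation g x.
  rewrite lt_neqAle violation_ge0 andbT eq_sym; apply/negP => /violation_eq0/xs_min.
  by move: xe => /=; lra.
exists (Num.min 1 (violation g x / 2)); first by rewrite lt_min ltr01 divr_gt0.
move=> y yd; rewrite leNgt; apply/negP => /ltW ye.
have : violation g x <= violation g y.
  apply: xmin; rewrite inE; split=> // i.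
  by rewrite (le_trans (yd i))// ge_min lexx.
have : violation g y <= violation g x / 2.
  apply/violation_le; first by rewrite divr_ge0// ltW.
  by move=> i; rewrite (le_trans (yd i))// ge_min lexx orbT.
lra.
Qed.

(** The value function is [mu t = f (arg t)], with [arg t] a minimizer of [f] on
    [sublevel g t], and a point [x] lies in the sublevel set of level
    [violation g x]. *)
Lemma holder_penalty_bound xs :
  feasible g xs -> (forall y, feasible g y -> polyfun f xs <= polyfun f y) ->
  exists alpha beta C : R, [/\ 0 < alpha, alpha <= 1 <= beta, 0 < C &
    forall x, 0 < violation g x ->
      polyfun f xs - polyfun f x <=
        C * (violation g x `^ alpha + violation g x `^ beta)].
Proof.
move=> xsS xs_min.
have /choice[arg hargs] : forall t, exists x, 0 <= t -> sublevel g t x /\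
    forall y, sublevel g t y -> polyfun f x <= polyfun f y.
  move=> t; have [t0|t0] := leP 0 t; last by exists 0.
  by have [x ? ?] := sublevel_minimizer t0; exists x.
pose mu t := polyfun f (arg t).
have argP t : 0 < t -> sublevel g t (arg t) /\
    forall y, sublevel g t y -> mu t <= polyfun f y by move=> /ltW/hargs.
have [P P0 Palg] := value_function_algebraic f g.
have [||||alpha [beta [C [alpha0 ab C0 hC]]]] :=
    algebraic_holder_bound (fstar := polyfun f xs) (mu := mu) P0.
- move=> t t0; have [targ tmin] := argP _ t0; apply: Palg => // y muy.
  by exists (arg t) => //; exact: ltW.
- by move=> t t0; have [_] := argP _ t0; apply; exact: feasible_sublevel (ltW t0) xsS.
- move=> t u t0 tu; have [targ _] := argP _ t0.
  have [_] := argP _ (lt_le_trans t0 tu); apply => i.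
  by rewrite (le_trans (targ i)).
- move=> e e0; have [d d0 hd] := almost_feasible_value xs_min e0.
  exists d => // t /andP[t0 td]; apply: hd => i.
  by have [targ _] := argP _ t0; rewrite (le_trans (targ i)).
exists alpha, beta, C; split=> // x v0.
apply: le_trans (hC _ v0); rewrite lerD2l lerN2.
by have [_] := argP _ v0; apply; apply/violation_le => //; exact: ltW.
Qed.

End PenaltyFunction.

Section ExactPenalty.
Context {R : realType} {n m : nat}.
Context (f : mpoly n R) (g : 'I_m -> mpoly n R).
Implicit Types (x : 'rV[R]_n).

Lemma inf_over_minimizer (A : set 'rV[R]_n) (h : 'rV[R]_n -> R) xs :
  A xs -> (forall y, A y -> h xs <= h y) -> inf_over A h = (h xs)%:E.
Proof.
move=> Axs xs_min; apply/eqP; rewrite eq_le; apply/andP; split.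
  by apply: ereal_inf_lbound; exists xs.
by apply: le_ereal_inf_tmp => _ [y Ay <-]; rewrite lee_fin xs_min.
Qed.

Lemma penalized_feasible (c alpha beta : R) x : 0 < alpha -> 0 < beta ->
  feasible g x -> penalized f g c alpha beta x = polyfun f x.
Proof.
move=> alpha0 beta0 /violation_eq0/eqP v0.
by rewrite /penalized v0 !powR0 ?gt_eqF// addr0 mulr0 addr0.
Qed.

Lemma exact_penalty_of_bound xs (alpha beta C : R) :
  feasible g xs -> (forall y, feasible g y -> polyfun f xs <= polyfun f y) ->
  0 < alpha -> alpha <= 1 <= beta -> 0 < C ->
  (forall x, 0 < violation g x -> polyfun f xs - polyfun f x <=
        C * (violation g x `^ alpha + violation g x `^ beta)) ->
  exact_penalty f g C alpha beta.
Proof.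
move=> xsS xs_min alpha0 ab C0 hC.
have beta0 : 0 < beta by have /andP[_] := ab; exact: lt_le_trans.
split=> // c Cc.
have pen_xs := penalized_feasible c alpha0 beta0 xsS.
rewrite (inf_over_minimizer xsS xs_min) (@inf_over_minimizer setT _ xs) ?pen_xs//.
  by rewrite ltNyr.
move=> x _; have [v0|v0] := eqVneq (violation g x) 0.
  have /violation_eq0 xS : violation g x == 0 by rewrite v0.
  by rewrite penalized_feasible// xs_min.
have {}v0 : 0 < violation g x by rewrite lt_neqAle eq_sym v0 violation_ge0.
have := hC x v0; rewrite /penalized.
have := powR_ge0 (violation g x) alpha; have := powR_ge0 (violation g x) beta.
move: (_ `^ alpha) (_ `^ beta) => A B B0 A0; nra.
Qed.

(** If a minimizer for [c] had positive violation, then its penalized value for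
    the midpoint of [c0] and [c] would be smaller than the minimum over the
    feasible set. *)
Lemma exact_penalty_argmin xs (c0 alpha beta c : R) :
  feasible g xs -> (forall y, feasible g y -> polyfun f xs <= polyfun f y) ->
  exact_penalty f g c0 alpha beta -> c0 < c ->
  argmin (feasible g) (polyfun f) = argmin setT (penalized f g c alpha beta) /\
  argmin setT (penalized f g c alpha beta) !=set0.
Proof.
move=> xsS xs_min [c00 alpha0 beta0 _ pen] c0c.
have infS := inf_over_minimizer xsS xs_min.
have pen_lb d x : c0 < d -> polyfun f xs <= penalized f g d alpha beta x.
  move=> /pen[+ _]; rewrite infS -lee_fin => ->.
  by apply: ereal_inf_lbound; exists x.
have sub x : argmin (feasible g) (polyfun f) x ->
    argmin setT (penalized f g c alpha beta) x.
  move=> [xS xmin]; split=> // y _.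
  by rewrite penalized_feasible// (le_trans (xmin _ xsS))// pen_lb.
split; last by exists xs; apply: sub.
apply/seteqP; split=> // x [_ xmin].
have xle : penalized f g c alpha beta x <= polyfun f xs.
  by rewrite -(penalized_feasible c alpha0 beta0 xsS) xmin.
have xS : feasible g x.
  apply/violation_eq0; apply: contrapT => /negP v0.
  pose d := (c0 + c) / 2.
  have c0d : c0 < d by rewrite /d; lra.
  have dc : d < c by rewrite /d; lra.
  have vgt0 : 0 < violation g x by rewrite lt_neqAle eq_sym v0 violation_ge0.
  have := powR_gt0 alpha vgt0; have := powR_gt0 beta vgt0.
  have := pen_lb d x c0d; move: xle; rewrite /penalized.
  by move: (_ `^ alpha) (_ `^ beta) => A B; nra.
split=> // y yS; apply: le_trans (xs_min _ yS).
by move: xle; rewrite penalized_feasible.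
Qed.

End ExactPenalty.

Theorem theorem6p1 (R : realType) (n m : nat) (f : mpoly n R)
    (g : 'I_m -> mpoly n R) (hmn : (m + 1 <= n)%N)
    (hS : feasible g !=set0)
    (hinf : inf_over (feasible g) (polyfun f) \is a fin_num)
    (hconv : convenient (cons_map f g))
    (hnondeg : nondegenerate_at_infinity (cons_map f g)) :
  ((exists c0 alpha beta : R, exact_penalty f g c0 alpha beta)
   <->
   (forall M : R, 0 <= M -> has_lbound [set polyfun f x | x in sublevel g M]))
  /\
  (forall c0 alpha beta : R, exact_penalty f g c0 alpha beta ->
   forall c : R, c0 < c ->
     argmin (feasible g) (polyfun f) = argmin setT (penalized f g c alpha beta)
     /\ argmin setT (penalized f g c alpha beta) !=set0).
Proof.
have lbound : exists l : R, forall x, feasible g x -> l <= polyfun f x.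
  exists (fine (inf_over (feasible g) (polyfun f))) => x xS.
  by rewrite -lee_fin fineK//; apply: ereal_inf_lbound; exists x.
have [xs xsS xs_min] := sublevel_minimizer lbound hconv hnondeg hS (lexx 0).
split; last first.
  by move=> c0 alpha beta pen c; exact: exact_penalty_argmin xsS xs_min pen.
split=> _.
  move=> M M0; have [x _ xmin] := sublevel_minimizer lbound hconv hnondeg hS M0.
  by exists (polyfun f x) => _ [y yM <-]; exact: xmin.
have [alpha [beta [C [alpha0 ab C0 hC]]]] :=
  holder_penalty_bound lbound hconv hnondeg hS xsS xs_min.
by exists C, alpha, beta; exact: exact_penalty_of_bound.
Qed.
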